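(* Consider $k\ge2$ coupled circuit DAEs, i.e. for $i=1,\dots,k$ $$0=A_{C_i}\tfrac{d}{dt}q_i(A_{C_i}^\top e_i)+A_{R_i}g_i(A_{R_i}^\top e_i)+A_{L_i}\jmath_{L_i}+A_{V_i}\jmath_{V_i}+A_{I_i}\imath_i(t)+A_{\lambda_i}\lambda,$$ $$0=\tfrac{d}{dt}\phi_i(\jmath_{L_i})-A_{L_i}^\top e_i,\qquad 0=A_{V_i}^\top e_i-v_i(t),$$ together with the coupling equation $0=\sum_{i=1}^kA_{\lambda_i}^\top e_i$, where the overall circuit satisfies the soundness and passivity assumptions. Then these equations, written as a single system, can be represented as a PH-DAE of the form $$\frac{d}{dt}Ex=\hat Jz(x)-r(z(x))+\bar B\bar u,\qquad \bar y=\bar B^\top z(x),$$ namely with $$x=\begin{pmatrix}q_C\\ \phi_L\\ e\\ \jmath_V\\ \lambda\end{pmatrix},\quad z(x)=\begin{pmatrix}e\\ \jmath_L\\ u_C\\ \jmath_V\\ \lambda\end{pmatrix}=\begin{pmatrix}e\\ \phi^{-1}(\phi_L)\\ q^{-1}(q_C)\\ \jmath_V\\ \lambda\end{pmatrix},\quad E=\begin{pmatrix}A_C&0&0&0&0\\0&I&0&0&0\\0&0&0&0&0\\0&0&0&0&0\\0&0&0&0&0\end{pmatrix},\quad r=\begin{pmatrix}A_Rg(A_R^\top e)\\0\\ A_C^\top e-u_C\\0\\0\end{pmatrix},$$ $$\hat J=\begin{pmatrix}0&-A_L&0&-A_V&-A_\lambda\\ A_L^\top&0&0&0&0\\0&0&0&0&0\\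 A_V^\top&0&0&0&0\\ A_\lambda^\top&0&0&0&0\end{pmatrix},\quad \bar B=\begin{pmatrix}-A_I&0\\0&0\\0&0\\0&-I\\0&0\end{pmatrix},\quad\bar u=\begin{pmatrix}\imath\\ v\end{pmatrix},$$ where unindexed quantities are the aggregations of the subsystem quantities.
   Context: PH-DAE. A system $\frac{d}{dt}Ex(t)=Jz(x(t))-r(z(x(t)))+Bu(t)$, $y(t)=B^\top z(x(t))$ with $E\in\mathbb{R}^{p\times n}$, $J\in\mathbb{R}^{p\times p}$, $B\in\mathbb{R}^{p\times m}$, $z:\mathbb{R}^n\to\mathbb{R}^p$, $r:\mathbb{R}^p\to\mathbb{R}^p$ is a port-Hamiltonian DAE (PH-DAE) if there exist a subspace $\mathcal V\subset\mathbb{R}^p$ and $H\in C^1(\mathbb{R}^n,\mathbb{R})$ (the Hamiltonian) such that: (i) for all intervals $\mathcal I$ and all $u:\mathcal I\to\mathbb{R}^m$ for which the system has a solution $x:\mathcal I\to\mathbb{R}^n$, $z(x(t))\in\mathcal V$ for all $t\in\mathcal I$; (ii) $v^\top Jw=-w^\top Jv$ for all $v,w\in\mathcal V$; (iii) $v^\top r(v)\ge0$ for all $v\in\mathcal V$; (iv) $\nabla H(x)=E^\top z(x)$ for all $x\in z^{-1}(\mathcal V)$. A solution is a function $x$ with $Ex$ differentiable satisfying the equation pointwise. Circuits. The $i$th subcircuit is a directed graph whose edges are capacitances, resistances, inductances, voltage sources and current sources; $A_{C_i},A_{R_i},A_{L_i},A_{V_i},A_{I_i}$ are the columns of its (grounded)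 incidence matrix belonging to the respective component types; $e_i$ are vertex potentials, $\jmath_{L_i},\jmath_{V_i}$ currents through inductances and voltage sources, $\imath_i(t),v_i(t)$ given sources. Charges and fluxes are $q_{C_i}=q_i(A_{C_i}^\top e_i)$ and $\phi_{L_i}=\phi_i(\jmath_{L_i})$. The subcircuits are joined by $n_\lambda$ edges carrying artificial voltage sources with zero voltage drop and currents $\lambda(t)\in\mathbb{R}^{n_\lambda}$; $A_{\lambda_i}$, with entries in $\{-1,0,1\}$ and $n_\lambda$ columns, is the incidence matrix of these edges with respect to the vertices of subcircuit $i$. Aggregation: $w=(w_1^\top,\dots,w_k^\top)^\top$ for the vectors $w\in\{q_C,\phi_L,e,u_C,\jmath_V,\jmath_L,\imath,v\}$; $A_P=\operatorname{diag}(A_{P_1},\dots,A_{P_k})$ for $P\in\{C,R,L,V,I\}$; $A_\lambda^\top=(A_{\lambda_1}^\top,\dots,A_{\lambda_k}^\top)$; $q,\phi,g$ act blockwise through $q_i,\phi_i,g_i$. Soundness: the overall circuit graph has at least one edge, is connected, and contains no cycle consisting only of voltage source edges and no cut consisting only of current source edges. Passivity: all $q_i$ and $\phi_i$ (self-maps of Euclidean spaces of the appropriate dimension) are bijective, continuously differentiable with everywhere symmetric positive definite Jacobians; each $g_i$ is continuously differentiable and the symmetric part of its Jacobian is everywhere positive definite.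
   Formalization: The formal statement additionally assumes g_i(0) = 0 for every i (zero resistor voltage gives zero current); without it the claim fails, e.g. for g_1(u) = u + 1, where v^T r(v) ≥ 0 is violated at a solution. *)

(* Defs.v *)
From HB Require Import structures.
From mathcomp Require Import all_boot all_order all_algebra.
From mathcomp Require Import all_classical all_reals all_analysis.

Set Implicit Arguments.
Unset Strict Implicit.
Unset Printing Implicit Defensive.

Import Order.TTheory GRing.Theory Num.Theory.
Import numFieldNormedType.Exports.

Local Open Scope classical_set_scope.
Local Open Scope ring_scope.

Record digraph := Digraph {
  vertex : finType;
  edge : finType;
  tail : edge -> vertex;
  head : edge -> vertex }.

Section Graph.
Variable G : digraph.

Definition adjacent : rel (vertex G) := fun a b =>
  [exists e : edge G, (tail e == a) && (head e == b)
                   || (tail e == b) && (head e == a)].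

Definition connected_graph : Prop := forall a b, connect adjacent a b.

(* A step is an edge with the sense in which it is traversed; [true] means
   along its direction. *)
Definition start (s : edge G * bool) : vertex G :=
  if s.2 then tail s.1 else head s.1.
Definition stop (s : edge G * bool) : vertex G :=
  if s.2 then head s.1 else tail s.1.

(* Simple cycles, directions being ignored: a loop is a cycle of length 1, and
   two parallel edges form a cycle of length 2. *)
Definition graph_cycle (s : seq (edge G * bool)) : Prop :=
  [/\ s <> [::], cycle (fun a b => stop a == start b) s,
      uniq [seq start a | a <- s] & uniq [seq a.1 | a <- s]].

(* F consists of the edges joining S to its complement, for some proper
   nonempty vertex set S. *)
Definition graph_cut (F : {set edge G}) : Prop :=
  exists S : {set vertex G},
    [/\ exists a, a \in S, exists b, b \notin S &
        forall e, (e \in F) = ((tail e \in S) != (head e \in S))].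

Definition sound_graph (isV isI : pred (edge G)) : Prop :=
  [/\ exists e : edge G, True,
      connected_graph,
      forall s, graph_cycle s -> ~ (forall a, a \in s -> isV a.1) &
      forall F, graph_cut F -> ~ (forall e, e \in F -> isI e)].

End Graph.

Section Calculus.
Variable R : realType.

Definition jac (m n : nat) (f : 'cV[R]_n -> 'cV[R]_m) (u : 'cV[R]_n) :
    'M[R]_(m, n) :=
  \matrix_(i, j) ('d f u (delta_mx j 0 : 'cV[R]_n)) i 0.

Definition C1 (m n : nat) (f : 'cV[R]_n -> 'cV[R]_m) : Prop :=
  (forall u, differentiable f u) /\ continuous (jac f).

Definition grad (n : nat) (H : 'cV[R]_n -> R) (x : 'cV[R]_n) : 'cV[R]_n :=
  \col_j ('d H x (delta_mx j 0 : 'cV[R]_n)).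

Definition C1_scalar (n : nat) (H : 'cV[R]_n -> R) : Prop :=
  (forall x, differentiable H x) /\ continuous (grad H).

Definition posdef (n : nat) (A : 'M[R]_n) : Prop :=
  forall h : 'cV[R]_n, h != 0 -> 0 < (h^T *m A *m h) 0 0.

Definition sym_part (n : nat) (A : 'M[R]_n) : 'M[R]_n := 2^-1 *: (A + A^T).

(* Derivatives on a time interval, one-sided at the end points belonging to
   it; hence time intervals have more than one point. *)
Definition time_interval (I : set R) : Prop :=
  is_interval I /\ exists a b, [/\ I a, I b & a < b].

Definition has_derivative_within (n : nat) (I : set R) (f : R -> 'cV[R]_n)
    (t : R) (df : 'cV[R]_n) : Prop :=
  (fun s => (s - t)^-1 *: (f s - f t)) @ within I t^' --> df.

End Calculus.

Section PHDAE.
Variables (R : realType) (n p m : nat).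
Variables (E : 'M[R]_(p, n)) (J : 'M[R]_p) (B : 'M[R]_(p, m)).
Variables (z : 'cV[R]_n -> 'cV[R]_p) (r : 'cV[R]_p -> 'cV[R]_p).

(* Only the values of u, x and y on I matter. *)
Definition phdae_solution (I : set R) (u : R -> 'cV[R]_m) (x : R -> 'cV[R]_n)
    (y : R -> 'cV[R]_m) : Prop :=
  forall t, I t ->
    has_derivative_within I (fun s => E *m x s) t
      (J *m z (x t) - r (z (x t)) + B *m u t) /\
    y t = B^T *m z (x t).

Definition is_phdae : Prop :=
  exists (V : {vspace 'cV[R]_p}) (H : 'cV[R]_n -> R),
    C1_scalar H /\
    [/\ forall I u x y, time_interval I -> phdae_solution I u x y ->
          forall t, I t -> z (x t) \in V,
        forall v w, v \in V -> w \in V -> v^T *m J *m w = - (w^T *m J *m v),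
        forall v, v \in V -> 0 <= (v^T *m r v) 0 0 &
        forall x, z x \in V -> grad H x = E^T *m z x].

End PHDAE.

Inductive component := Cap | Res | Ind | Vsrc | Isrc.

Definition component_code (P : component) : 'I_5 :=
  inord (match P with Cap => 0 | Res => 1 | Ind => 2 | Vsrc => 3 | Isrc => 4 end).

Definition component_decode (i : 'I_5) : component :=
  nth Cap [:: Cap; Res; Ind; Vsrc; Isrc] i.

Lemma component_codeK : cancel component_code component_decode.
Proof. by case; rewrite /component_decode /component_code inordK. Qed.

HB.instance Definition _ := Finite.copy component (can_type component_codeK).

(* A vertex is [Some a] for one of the non-grounded vertices a, or [None] for
   the ground. *)
Record subcircuit (R : realType) := Subcircuit {
  nnode : nat;
  nedge : component -> nat;
  etail : forall P, 'I_(nedge P) -> option 'I_nnode;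
  ehead : forall P, 'I_(nedge P) -> option 'I_nnode;
  charge_fun : 'cV[R]_(nedge Cap) -> 'cV[R]_(nedge Cap);
  flux_fun : 'cV[R]_(nedge Ind) -> 'cV[R]_(nedge Ind);
  conductance_fun : 'cV[R]_(nedge Res) -> 'cV[R]_(nedge Res) }.

(* The joining edges run between vertices, possibly the ground, of two distinct
   subcircuits. *)
Record coupled_circuit (R : realType) (k : nat) := CoupledCircuit {
  sub : 'I_k -> subcircuit R;
  nlam : nat;
  ltail : 'I_nlam -> {i : 'I_k & option 'I_(nnode (sub i))};
  lhead : 'I_nlam -> {i : 'I_k & option 'I_(nnode (sub i))};
  ljoin : forall l, projT1 (ltail l) != projT1 (lhead l) }.

Section Subcircuit.
Variables (R : realType) (S : subcircuit R).

Definition incidence (P : component) : 'M[R]_(nnode S, nedge S P) :=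
  \matrix_(a, e) ((@etail R S P e == Some a)%:R - (@ehead R S P e == Some a)%:R).

Definition reactive_passive (n : nat) (f : 'cV[R]_n -> 'cV[R]_n) : Prop :=
  [/\ bijective f, C1 f, forall u, (jac f u)^T = jac f u &
      forall u, posdef (jac f u)].

Definition passive : Prop :=
  [/\ reactive_passive (@charge_fun R S),
      reactive_passive (@flux_fun R S),
      C1 (@conductance_fun R S) &
      forall u, posdef (sym_part (jac (@conductance_fun R S) u))].

End Subcircuit.

Section Coupled.
Variables (R : realType) (k : nat) (S : coupled_circuit R k).

Notation NN i := (nnode (sub S i)).
Notation NE i P := (nedge (sub S i) P).

(* The grounds of the subcircuits are one and the same vertex, [None]. *)
Definition overall_vertex : finType := option {i : 'I_k & 'I_(NN i)}.

Definition to_overall (i : 'I_k) (a : option 'I_(NN i)) : overall_vertex :=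
  omap (fun b => existT (fun j => 'I_(NN j)) i b) a.

Definition overall_edge : finType :=
  ({i : 'I_k & {P : component & 'I_(NE i P)}} + 'I_(nlam S))%type.

Definition overall_tail (e : overall_edge) : overall_vertex :=
  match e with
  | inl (existT i (existT P c)) => to_overall (etail c)
  | inr l => to_overall (projT2 (ltail l))
  end.

Definition overall_head (e : overall_edge) : overall_vertex :=
  match e with
  | inl (existT i (existT P c)) => to_overall (ehead c)
  | inr l => to_overall (projT2 (lhead l))
  end.

Definition overall_graph : digraph := Digraph overall_tail overall_head.

(* The joining edges carry (artificial) voltage sources. *)
Definition is_vsrc (e : edge overall_graph) : bool :=
  match (e : overall_edge) with
  | inl (existT _ (existT P _)) => P == Vsrc
  | inr _ => true
  end.

Definition is_isrc (e : edge overall_graph) : bool :=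
  match (e : overall_edge) with
  | inl (existT _ (existT P _)) => P == Isrc
  | inr _ => false
  end.

Definition sound : Prop := sound_graph is_vsrc is_isrc.

Definition A_ (P : component) (i : 'I_k) : 'M[R]_(NN i, NE i P) :=
  incidence (sub S i) P.

Definition Alam_ (i : 'I_k) : 'M[R]_(NN i, nlam S) :=
  \matrix_(a, l)
    ((ltail l == existT (fun j => option 'I_(NN j)) i (Some a))%:R
     - (lhead l == existT (fun j => option 'I_(NN j)) i (Some a))%:R).

Definition q_ (i : 'I_k) := @charge_fun R (sub S i).
Definition phi_ (i : 'I_k) := @flux_fun R (sub S i).
Definition g_ (i : 'I_k) := @conductance_fun R (sub S i).

Definition circuit_solution (I : set R)
    (cur : forall i : 'I_k, R -> 'cV[R]_(NE i Isrc))
    (vol : forall i : 'I_k, R -> 'cV[R]_(NE i Vsrc))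
    (e : forall i : 'I_k, R -> 'cV[R]_(NN i))
    (jL : forall i : 'I_k, R -> 'cV[R]_(NE i Ind))
    (jV : forall i : 'I_k, R -> 'cV[R]_(NE i Vsrc))
    (lam : R -> 'cV[R]_(nlam S)) : Prop :=
  forall t, I t ->
    (forall i, exists (dq : 'cV[R]_(NE i Cap)) (dphi : 'cV[R]_(NE i Ind)),
       [/\ has_derivative_within I (fun s => q_ ((A_ Cap i)^T *m e i s)) t dq,
           has_derivative_within I (fun s => phi_ (jL i s)) t dphi,
           0 = A_ Cap i *m dq + A_ Res i *m g_ ((A_ Res i)^T *m e i t)
               + A_ Ind i *m jL i t + A_ Vsrc i *m jV i t
               + A_ Isrc i *m cur i t + Alam_ i *m lam t,
           0 = dphi - (A_ Ind i)^T *m e i t &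
           0 = (A_ Vsrc i)^T *m e i t - vol i t]) /\
    0 = \sum_i (Alam_ i)^T *m e i t.

Definition nN : nat := \sum_i NN i.
Definition nE (P : component) : nat := \sum_i NE i P.

(* [mxdiag] is restricted to square blocks; this is its definition for
   rectangular ones. *)
Definition A (P : component) : 'M[R]_(nN, nE P) :=
  \mxblock_(i, j) (if i == j then conform_mx 0 (A_ P i) else 0).

Definition Alam : 'M[R]_(nN, nlam S) := \mxcol_i Alam_ i.

Definition blockwise (d : 'I_k -> nat) (f : forall i, 'cV[R]_(d i) -> 'cV[R]_(d i))
    (u : 'cV[R]_(\sum_i d i)) : 'cV[R]_(\sum_i d i) :=
  \mxcol_i f i (submxcol u i).

Definition q : 'cV[R]_(nE Cap) -> 'cV[R]_(nE Cap) := blockwise q_.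
Definition phi : 'cV[R]_(nE Ind) -> 'cV[R]_(nE Ind) := blockwise phi_.
Definition g : 'cV[R]_(nE Res) -> 'cV[R]_(nE Res) := blockwise g_.

(* Inverse functions; meaningful since q and phi are bijective under the
   passivity assumption. *)
Definition qinv : 'cV[R]_(nE Cap) -> 'cV[R]_(nE Cap) := pinv [set: _] q.
Definition phiinv : 'cV[R]_(nE Ind) -> 'cV[R]_(nE Ind) := pinv [set: _] phi.

Definition col5 (c n1 n2 n3 n4 n5 : nat) (M1 : 'M[R]_(n1, c)) (M2 : 'M[R]_(n2, c))
    (M3 : 'M[R]_(n3, c)) (M4 : 'M[R]_(n4, c)) (M5 : 'M[R]_(n5, c)) :=
  col_mx M1 (col_mx M2 (col_mx M3 (col_mx M4 M5))).

Definition row5 (c n1 n2 n3 n4 n5 : nat) (M1 : 'M[R]_(c, n1)) (M2 : 'M[R]_(c, n2))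
    (M3 : 'M[R]_(c, n3)) (M4 : 'M[R]_(c, n4)) (M5 : 'M[R]_(c, n5)) :=
  row_mx M1 (row_mx M2 (row_mx M3 (row_mx M4 M5))).

(* x = (q_C, phi_L, e, j_V, lambda) and z = (e, j_L, u_C, j_V, lambda) *)
Definition dimx : nat := nE Cap + (nE Ind + (nN + (nE Vsrc + nlam S))).
Definition dimz : nat := nN + (nE Ind + (nE Cap + (nE Vsrc + nlam S))).

Definition E_ph : 'M[R]_(dimz, dimx) :=
  col5 (row5 (A Cap) 0    0 0 0)
       (row5 0       1%:M 0 0 0)
       (row5 0       0    0 0 0)
       (row5 0       0    0 0 0)
       (row5 0       0    0 0 0).

Definition J_ph : 'M[R]_dimz :=
  col5 (row5 0             (- A Ind) 0 (- A Vsrc) (- Alam))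
       (row5 ((A Ind)^T)   0         0 0          0)
       (row5 0             0         0 0          0)
       (row5 ((A Vsrc)^T)  0         0 0          0)
       (row5 (Alam^T)      0         0 0          0).

Definition B_ph : 'M[R]_(dimz, nE Isrc + nE Vsrc) :=
  col5 (row_mx (- A Isrc) 0)
       (row_mx 0          0)
       (row_mx 0          0)
       (row_mx 0          (- 1%:M))
       (row_mx 0          0).

Definition z_ph (x : 'cV[R]_dimx) : 'cV[R]_dimz :=
  let qC := usubmx x in
  let phiL := usubmx (dsubmx x) in
  let e := usubmx (dsubmx (dsubmx x)) in
  let jV := usubmx (dsubmx (dsubmx (dsubmx x))) in
  let lam := dsubmx (dsubmx (dsubmx (dsubmx x))) in
  col5 e (phiinv phiL) (qinv qC) jV lam.

Definition r_ph (w : 'cV[R]_dimz) : 'cV[R]_dimz :=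
  let e := usubmx w in
  let uC := usubmx (dsubmx (dsubmx w)) in
  col5 (A Res *m g ((A Res)^T *m e)) 0 ((A Cap)^T *m e - uC) 0 0.

Definition u_ph (cur : forall i : 'I_k, R -> 'cV[R]_(NE i Isrc))
    (vol : forall i : 'I_k, R -> 'cV[R]_(NE i Vsrc)) (t : R) :
    'cV[R]_(nE Isrc + nE Vsrc) :=
  col_mx (\mxcol_i cur i t) (\mxcol_i vol i t).

(* x and z(x) along circuit trajectories, with q_C = q(A_C^T e),
   phi_L = phi(j_L) and u_C = A_C^T e *)
Definition x_ph (e : forall i : 'I_k, R -> 'cV[R]_(NN i))
    (jL : forall i : 'I_k, R -> 'cV[R]_(NE i Ind))
    (jV : forall i : 'I_k, R -> 'cV[R]_(NE i Vsrc))
    (lam : R -> 'cV[R]_(nlam S)) (t : R) : 'cV[R]_dimx :=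
  col5 (\mxcol_i q_ ((A_ Cap i)^T *m e i t)) (\mxcol_i phi_ (jL i t))
       (\mxcol_i e i t) (\mxcol_i jV i t) (lam t).

Definition zx_ph (e : forall i : 'I_k, R -> 'cV[R]_(NN i))
    (jL : forall i : 'I_k, R -> 'cV[R]_(NE i Ind))
    (jV : forall i : 'I_k, R -> 'cV[R]_(NE i Vsrc))
    (lam : R -> 'cV[R]_(nlam S)) (t : R) : 'cV[R]_dimz :=
  col5 (\mxcol_i e i t) (\mxcol_i jL i t) (\mxcol_i ((A_ Cap i)^T *m e i t))
       (\mxcol_i jV i t) (lam t).

End Coupled.

(* Main.v *)
(* The constraint space of the PH-DAE is V = {A_C^T e = u_C}, and its Hamiltonian
   is the sum of the Legendre transforms of potentials of q and phi.  Potentials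
   exist because the Jacobians are symmetric (Poincare lemma on rays), and their
   Legendre transforms have the gradients q^-1 and phi^-1 because q and phi are
   strictly monotone with continuous inverses.
   The circuit equations require q(A_C^T e) to be differentiable, the PH-DAE only
   A_C q(A_C^T e).  The latter determines A_C^T e through a map with positive
   definite Jacobian, hence is differentiable only if the former is. *)
Require Import Defs.
From HB Require Import structures.
From mathcomp Require Import all_boot all_order all_algebra.
From mathcomp Require Import all_classical all_reals all_analysis.
From mathcomp Require Import ring lra.
Import Order.TTheory GRing.Theory Num.Theory.
Import numFieldNormedType.Exports.
Local Open Scope classical_set_scope.
Local Open Scope ring_scope.
Set Implicit Arguments.
Unset Strict Implicit.
Unset Printing Implicit Defensive.

(** * Euclidean products and coordinates *)

Section Dot.
Context {R : realType}.

(** The third row of the system reads 0 = u_C - A_C^T e, so solutions cannot leave V. Off V the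
    third block of r contributes u_C . (A_C^T e - u_C), which can be negative; on V it vanishes and
    v . r(v) becomes a . g(a) with a = A_R^T e. Passivity controls only differences of g, so the
    sign of a . g(a) comes from comparing a with 0, where the current vanishes. The gradient of the
    Hamiltonian has q^-1(q_C) where E^T z has A_C^T e; the two agree exactly on V. The inverses of q
    and phi are never differentiated. Potentials enter through the inequality F(u) + (v - u) . f(u)
    <= F(v), which encodes convexity and gradient at once. Like monotonicity it adds up over
    subcircuits, so no Jacobian of an aggregated map is ever computed. *)

Definition dot n (u v : 'cV[R]_n) : R := \sum_i u i 0 * v i 0.

Lemma dotE n (u v : 'cV[R]_n) : dot u v = (u^T *m v) 0 0.
Proof. by rewrite mxE; apply: eq_bigr => i _; rewrite mxE. Qed.

Lemma dotC n (u v : 'cV[R]_n) : dot u v = dot v u.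
Proof. by apply: eq_bigr => i _; rewrite mulrC. Qed.

Lemma dotDr n (u v w : 'cV[R]_n) : dot u (v + w) = dot u v + dot u w.
Proof. by rewrite -big_split; apply: eq_bigr => i _; rewrite mxE mulrDr. Qed.

Lemma dotZr n (u v : 'cV[R]_n) (a : R) : dot u (a *: v) = a * dot u v.
Proof. by rewrite mulr_sumr; apply: eq_bigr => i _; rewrite mxE mulrCA. Qed.

Lemma dotNr n (u v : 'cV[R]_n) : dot u (- v) = - dot u v.
Proof. by rewrite -scaleN1r dotZr mulN1r. Qed.

Lemma dotBr n (u v w : 'cV[R]_n) : dot u (v - w) = dot u v - dot u w.
Proof. by rewrite dotDr dotNr. Qed.

Lemma dot0r n (u : 'cV[R]_n) : dot u 0 = 0.
Proof. by rewrite -[0 in LHS](subrr u) dotBr subrr. Qed.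

Lemma dotDl n (u v w : 'cV[R]_n) : dot (v + w) u = dot v u + dot w u.
Proof. by rewrite !(dotC _ u) dotDr. Qed.

Lemma dotZl n (u v : 'cV[R]_n) (a : R) : dot (a *: v) u = a * dot v u.
Proof. by rewrite !(dotC _ u) dotZr. Qed.

Lemma dotBl n (u v w : 'cV[R]_n) : dot (v - w) u = dot v u - dot w u.
Proof. by rewrite !(dotC _ u) dotBr. Qed.

Lemma dot_mulmx m n (u : 'cV[R]_m) (A : 'M[R]_(m, n)) (v : 'cV[R]_n) :
  dot u (A *m v) = dot (A^T *m u) v.
Proof. by rewrite !dotE trmx_mul trmxK mulmxA. Qed.

Lemma dot_col_mx m n (u v : 'cV[R]_m) (u' v' : 'cV[R]_n) :
  dot (col_mx u u') (col_mx v v') = dot u v + dot u' v'.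
Proof. by rewrite !dotE tr_col_mx mul_row_col mxE. Qed.

Lemma le_norm_coord m n (u : 'M[R]_(m, n)) i j : `|u i j| <= `|u|.
Proof.
rewrite [leRHS]/(@Num.norm _ _ u) /= mx_normrE.
exact: (le_bigmax _ (fun ij : 'I_m * 'I_n => `|u ij.1 ij.2|) (i, j)).
Qed.

Lemma norm_mx_le m n (u : 'M[R]_(m, n)) (a : R) :
  0 <= a -> (forall i j, `|u i j| <= a) -> `|u| <= a.
Proof.
move=> a0 ua; rewrite [leLHS]/(@Num.norm _ _ u) /= mx_normrE.
by apply/bigmax_leP; split=> // -[i j] _; exact: ua.
Qed.

(** The matrix norm is the largest absolute entry, so the dimension replaces the constant 1 of
    Cauchy-Schwarz. This is the origin of the factors [n%:R] in later estimates. *)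
Lemma norm_dot_le n (u v : 'cV[R]_n) : `|dot u v| <= n%:R * `|u| * `|v|.
Proof.
apply: le_trans (ler_norm_sum _ _ _) _.
rewrite -mulrA; set c := `|u| * _.
have -> : n%:R * c = \sum_(i < n) c by rewrite sumr_const card_ord mulr_natl.
by apply: ler_sum => i _; rewrite normrM ler_pM ?le_norm_coord.
Qed.

Lemma norm_mulmx_le m n (A : 'M[R]_(m, n)) (v : 'cV[R]_n) :
  `|A *m v| <= n%:R * `|A| * `|v|.
Proof.
apply: norm_mx_le => [|i j]; first by rewrite !mulr_ge0.
rewrite mxE; apply: le_trans (ler_norm_sum _ _ _) _.
rewrite -mulrA; set c := `|A| * _.
have -> : n%:R * c = \sum_(k < n) c by rewrite sumr_const card_ord mulr_natl.
by apply: ler_sum => k _; rewrite normrM ler_pM ?le_norm_coord.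
Qed.

Lemma cvg_mx_coord (T : Type) (F : set_system T) {FF : Filter F} m n
    (f : T -> 'M[R]_(m, n)) (l : 'M[R]_(m, n)) :
  (forall i j, f x i j @[x --> F] --> l i j) -> f @ F --> l.
Proof.
move=> fl; apply/cvgrPdist_le => e e0.
have : \forall x \near F, forall ij : 'I_m * 'I_n, `|l ij.1 ij.2 - f x ij.1 ij.2| <= e.
  apply: filter_forall => -[i j].
  by have /cvgrPdist_le/(_ _ e0) := fl i j.
apply: filterS => x fx; apply: norm_mx_le => [|i j]; first exact: ltW.
by rewrite !mxE; exact: fx (i, j).
Qed.

Lemma cvg_coord (T : Type) (F : set_system T) {FF : Filter F} m n
    (f : T -> 'M[R]_(m, n)) (l : 'M[R]_(m, n)) i j :
  f @ F --> l -> f x i j @[x --> F] --> l i j.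
Proof. by move=> fl; exact: (cvg_comp _ _ fl (@coord_continuous _ _ _ i j l)). Qed.

Lemma cvg_mulmx (T : Type) (F : set_system T) {FF : Filter F} m n p
    (f : T -> 'M[R]_(m, n)) (h : T -> 'M[R]_(n, p))
    (a : 'M[R]_(m, n)) (b : 'M[R]_(n, p)) :
  f @ F --> a -> h @ F --> b -> f x *m h x @[x --> F] --> a *m b.
Proof.
move=> fa hb; apply: cvg_mx_coord => i j.
under eq_fun do rewrite mxE.
rewrite mxE; apply: cvg_big => [|k _]; first exact: add_continuous.
by apply: cvgM; exact: cvg_coord.
Qed.

Lemma cvg_dot (T : Type) (F : set_system T) {FF : Filter F} n
    (f h : T -> 'cV[R]_n) (a b : 'cV[R]_n) :
  f @ F --> a -> h @ F --> b -> dot (f x) (h x) @[x --> F] --> dot a b.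
Proof.
move=> fa hb; apply: cvg_big => [|k _]; first exact: add_continuous.
by apply: cvgM; exact: cvg_coord.
Qed.

End Dot.

(** * Monotone maps *)

Section Lines.
Context {R : realType}.

Lemma diffE_jac m n (f : 'cV[R]_n -> 'cV[R]_m) (u h : 'cV[R]_n) :
  'd f u h = jac f u *m h.
Proof.
have -> : h = \sum_j h j 0 *: (delta_mx j 0 : 'cV[R]_n).
  rewrite {1}[h]matrix_sum_delta; apply: eq_bigr => j _.
  by rewrite big_ord1.
rewrite linear_sum mulmx_sumr /=; apply: eq_bigr => j _.
rewrite linearZ -scalemxAr /=; congr (_ *: _).
apply/matrixP => i k; rewrite ord1 !mxE (bigD1 j) //= big1 ?addr0.
  by rewrite !mxE !eqxx mulr1.
by move=> l lj; rewrite !mxE (negPf lj) mulr0.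
Qed.

Lemma is_derive_cvg (V W : normedModType R) (f : V -> W) (a v : V) (df : W) :
  h^-1 *: ((f \o shift a) (h *: v) - f a) @[h --> 0^'] --> df ->
  is_derive a v f df.
Proof. by move=> fdf; apply: DeriveDef; [exact: cvgP fdf|exact: cvg_lim]. Qed.

Lemma is_derive_dot_line m n (f : 'cV[R]_n -> 'cV[R]_m) (x d : 'cV[R]_n)
    (v : 'cV[R]_m) (a : R) :
  differentiable f (x + a *: d) ->
  is_derive a (1 : R) (fun t : R => dot v (f (x + t *: d)))
    (dot v (jac f (x + a *: d) *m d)).
Proof.
move=> df; apply: is_derive_cvg.
have fd : derivable f (x + a *: d) d by exact: diff_derivable.
have := deriveE d df; rewrite diffE_jac => <-.
move/cvg_ex : fd => [l fl].
have -> : 'D_d f (x + a *: d) = l by apply: cvg_lim fl.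
have : dot v (h^-1 *: ((f \o shift (x + a *: d)) (h *: d) - f (x + a *: d)))
    @[h --> 0^'] --> dot v l.
  by apply: cvg_dot fl; exact: cvg_cst.
apply: cvg_trans.
apply: near_eq_cvg; near=> h => /=.
rewrite dotZr dotBr /= scaler1 scalerDl.
by rewrite (addrCA (h *: d)).
Unshelve. all: by end_near. Qed.

(** The mean value theorem has no equality form for vector-valued maps. Pairing with the fixed
    direction [d] gives a real function whose derivative along the segment is the quadratic form of
    the Jacobian. *)
Lemma strictly_monotone_posdef n (f : 'cV[R]_n -> 'cV[R]_n) :
  (forall u, differentiable f u) ->
  (forall u h, h != 0 -> 0 < dot h (jac f u *m h)) ->
  forall u v, u != v -> 0 < dot (v - u) (f v - f u).
Proof.
move=> df jf u v uv; set d := v - u.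
have d0 : d != 0 by rewrite subr_eq0 eq_sym.
have dphi (t : R) : is_derive t (1 : R) (fun t : R => dot d (f (u + t *: d)))
    (dot d (jac f (u + t *: d) *m d)) by exact: is_derive_dot_line.
have [|c _] := @MVT R _ _ 0 1 ltr01 (fun t _ => dphi t).
  apply: continuous_subspaceT => t; apply: differentiable_continuous.
  by apply/derivable1_diffP; exact: (@ex_derive _ _ _ _ _ _ _ (dphi t)).
have ud : u + d = v by rewrite addrC subrK.
rewrite subr0 mulr1 scale1r scale0r addr0 ud dotBr => ->.
exact: jf.
Qed.

(** By compactness [dot w (f (u + w) - f u)] has a positive minimum on the sphere of radius [e].
    Monotonicity along rays from [u] carries this lower bound outwards, so beyond the sphere [f]
    stays away from [f u]. *)
Lemma continuous_inverse_monotone n (f : 'cV[R]_n -> 'cV[R]_n) :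
  continuous f ->
  (forall u v, u != v -> 0 < dot (v - u) (f v - f u)) ->
  forall u (e : R), 0 < e ->
  exists2 r : R, 0 < r & forall v, `|f v - f u| < r -> `|v - u| < e.
Proof.
move=> cf mf u e e0.
(* Row vectors, because [bounded_closed_compact] speaks of these. *)
pose C := [set w : 'rV[R]_n | `|w^T| = e].
pose phi (w : 'rV[R]_n) := dot w^T (f (u + w^T) - f u).
have ctr : continuous (fun w : 'rV[R]_n => w^T).
  move=> w; apply: (@cvg_mx_coord _ _ (nbhs w) (nbhs_filter w)) => i j.
  by under eq_fun do rewrite mxE; rewrite mxE; exact: coord_continuous.
have normT (w : 'rV[R]_n) : `|w| <= `|w^T|.
  by apply: norm_mx_le => // i j; have := le_norm_coord w^T j i; rewrite mxE.
have cC : compact C.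
  apply: bounded_closed_compact.
    exists e; split; first exact: num_real.
    by move=> M eM w /= Cw; rewrite (le_trans (normT w)) // Cw ltW.
  rewrite (_ : C = (fun w : 'rV[R]_n => `|w^T|) @^-1` [set e]) //.
  apply: closed_comp; last exact: closed_eq.
  by move=> w _; exact: (cvg_norm (ctr w)).
have cphi : continuous phi.
  move=> w; apply: (cvg_dot (ctr w)); apply: cvgB; last exact: cvg_cst.
  have cw : u + w^T @[w --> w] --> u + w^T.
    exact: (cvgD (cvg_cst u) (ctr w)).
  exact: (cvg_comp _ _ cw (cf _)).
have far v : e <= `|v - u| -> exists2 w, C w &
    phi w <= n%:R * e * `|f v - f u|.
  move=> ev; set D := `|v - u| in ev *.
  have D0 : 0 < D := lt_le_trans e0 ev.
  (* [u + d] is where the segment from [u] to [v] meets the sphere. Since [v - (u + d)] is a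
     nonnegative multiple of [v - u], monotonicity between [u + d] and [v] gives the comparison
     below. *)
  pose d := (e / D) *: (v - u).
  have nd : `|d| = e.
    by rewrite normrZ ger0_norm ?divr_ge0 1?ltW// divfK // gt_eqF.
  exists d^T; rewrite /C /phi /= trmxK //.
  suff : dot d (f (u + d) - f u) <= dot d (f v - f u).
    move=> /le_trans; apply; apply: le_trans (ler_norm _) _.
    by rewrite (le_trans (norm_dot_le _ _)) // nd.
  rewrite -subr_ge0 -dotBr opprB addrA subrK.
  have [->|neq] := eqVneq (u + d) v; first by rewrite subrr dot0r.
  have := mf _ _ neq; rewrite {1}/d opprD addrA -{1}[v - u]scale1r -scalerBl.
  rewrite dotZl /d dotZl => H.
  have eD : 0 <= 1 - e / D by rewrite subr_ge0 ler_pdivrMr ?mul1r.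
  apply: mulr_ge0; first by rewrite divr_ge0 // ltW.
  rewrite -(pmulr_rge0 _ (_ : 0 < 1 - e / D)); first exact: ltW.
  rewrite lt_neqAle eD andbT eq_sym; apply: contraTneq H => ->.
  by rewrite mul0r ltxx.
(* In dimension 0 the sphere is empty: no [v] lies at distance [e] or more, and any radius
   serves. *)
have [[w0 Cw0]|C0] := pselect (C !=set0); last first.
  exists 1 => // v _; rewrite ltNge; apply/negP => /far[w Cw _].
  by apply: C0; exists w.
have [|w1] := @compact_EVT_min _ R phi C _ cC (continuous_subspaceT cphi).
  by exists w0.
rewrite inE => Cw1 minw1.
have m0 : 0 < phi w1.
  have := mf u (u + w1^T); rewrite /phi addrAC subrr add0r; apply.
  rewrite -subr_eq0 opprD addrA subrr add0r oppr_eq0 -normr_eq0.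
  by rewrite Cw1 gt_eqF.
have K0 : 0 < n%:R * e + 1 by rewrite ltr_wpDl // mulr_ge0 // ltW.
exists (phi w1 / (n%:R * e + 1)) => [|v]; first exact: divr_gt0.
rewrite ltr_pdivlMr // => fv; rewrite ltNge; apply/negP => /far[w Cw le].
have := minw1 w; rewrite inE => /(_ Cw) /le_trans /(_ le).
apply/negP; rewrite -ltNge; apply: le_lt_trans fv.
by rewrite mulrC ler_wpM2l // lerDl.
Qed.

End Lines.

(** * Potentials of monotone maps with symmetric Jacobian *)

Section Potential.
Context {R : realType}.
Let mu := @lebesgue_measure R.

Lemma compact_segmentX (a b c d : R) : compact (`[a, b] `*` `[c, d] : set (R * R)).
Proof. by apply: compact_setX; exact: segment_compact. Qed.

Lemma continuous_lineM n (u d : 'cV[R]_n) :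
  continuous (fun p : R * R => p.2 *: (u + p.1 *: d)).
Proof.
move=> p; apply: cvgZ; first exact: cvg_snd.
apply: (cvgD (cvg_cst u)); apply: cvgZ; [exact: cvg_fst|exact: cvg_cst].
Qed.

(** The integral is the radial potential of the Poincare lemma. Its derivative is taken along a line
    only, so that differentiation under the integral sign involves a single real parameter. *)
Lemma is_derive_ray_integral n (f : 'cV[R]_n -> 'cV[R]_n) (u d : 'cV[R]_n)
    (a : R) :
  C1 f -> (forall u, (jac f u)^T = jac f u) ->
  is_derive a (1 : R)
    (fun t : R => \int[mu]_(s in `[0%R, 1%R]) dot (u + t *: d) (f (s *: (u + t *: d))))
    (dot d (f (u + a *: d))).
Proof.
move=> [df cj] sj.
have cf : continuous f by move=> x; exact: differentiable_continuous.
(* By symmetry of the Jacobian, the [t]-derivative of the integrand at [t = a]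
   is the [s]-derivative of [s * dot d (f (s *: (u + a *: d)))]. *)
pose Phi (t s : R) := dot (u + t *: d) (f (s *: (u + t *: d))).
pose K (p : R * R) := dot d (f (p.2 *: (u + p.1 *: d)))
  + p.2 * dot (u + p.1 *: d) (jac f (p.2 *: (u + p.1 *: d)) *m d).
have lin (p : R * R) : u + x.1 *: d @[x --> p] --> u + p.1 *: d.
  apply: (cvgD (cvg_cst u)); apply: cvgZ; [exact: cvg_fst|exact: cvg_cst].
have cfl (p : R * R) : f (x.2 *: (u + x.1 *: d)) @[x --> p] -->
    f (p.2 *: (u + p.1 *: d)).
  exact: (cvg_comp _ _ (@continuous_lineM n u d p) (cf _)).
have cjl (p : R * R) : jac f (x.2 *: (u + x.1 *: d)) @[x --> p] -->
    jac f (p.2 *: (u + p.1 *: d)).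
  exact: (cvg_comp _ _ (@continuous_lineM n u d p) (cj _)).
have cK : continuous K.
  move=> p; have cd : (fun=> d) @ p --> d by exact: cvg_cst.
  apply: (cvgD (cvg_dot cd (cfl p))).
  exact: (cvgM cvg_snd (cvg_dot (lin p) (cvg_mulmx (cjl p) cd))).
have pairc (t : R) : continuous (fun s : R => (t, s)).
  move=> s; have ct : (fun=> t) @ nbhs s --> t by exact: cvg_cst.
  exact: (@cvg_pair _ _ _ (nbhs s) (nbhs t) (nbhs s) _ _ _ _ _ ct cvg_id).
have dPhi t s : is_derive t (1 : R) (Phi ^~ s) (K (t, s)).
  pose h t := f (s *: u + t *: (s *: d)).
  have -> : Phi ^~ s = (fun t => dot u (h t)) + (id \* (fun t => dot d (h t))).
    apply/funext => t'; rewrite /Phi /h /= dotDl dotZl.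
    by rewrite scalerDr scalerA mulrC -scalerA.
  have H v : is_derive t (1 : R) (fun t => dot v (h t))
      (dot v (jac f (s *: u + t *: (s *: d)) *m (s *: d))).
    exact: is_derive_dot_line.
  apply: is_derive_eq.
  rewrite /K /h /= scalerDr !scalerA (mulrC t s) -scalemxAr !dotZr dotDl dotZl.
  rewrite -[t *: _]/(t * _) -[X in _ + (_ + X)]/(_ * 1).
  ring.
have iPhi t : mu.-integrable `[0, 1] (EFin \o Phi t).
  apply: continuous_compact_integrable; first exact: segment_compact.
  apply: continuous_subspaceT => s.
  apply: (cvg_dot (cvg_cst _)).
  exact: (cvg_comp _ _ (pairc t s) (cfl (t, s))).
(* Differentiating under the integral requires a bound uniform in [t] near [a]: the jointly
   continuous [K] is bounded on this compact rectangle. The dominating constant will be [|M| + 1],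
   which exceeds [M] and is nonnegative. *)
have : bounded_set (K @` (`[a - 1, a + 1] `*` `[0, 1])).
  apply: compact_bounded; apply: continuous_compact.
    exact: continuous_subspaceT.
  exact: compact_segmentX.
move=> [M [Mr KM]].
have part t s : partial1of2 Phi t s = K (t, s).
  by rewrite partial1of2E; exact: derive_val.
have Ia : `]a - 1, a + 1[%classic a.
  by rewrite /= in_itv /= ltrBlDr ltrDl ltr01.
have KM1 t s : `]a - 1, a + 1[%classic t -> `[0, 1]%classic s ->
    `|partial1of2 Phi t s| <= `|M| + 1.
  rewrite /= !in_itv /= => /andP[t0 t1] /andP[s0 s1]; rewrite part.
  apply: KM; first by rewrite ltr_pwDr // ler_norm.
  by exists (t, s) => //; split; rewrite /= in_itv /= ?s0 // !ltW.
have iM : mu.-integrable `[0, 1] (EFin \o (fun=> `|M| + 1)).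
  apply: continuous_compact_integrable; first exact: segment_compact.
  by apply: continuous_subspaceT => s; exact: cvg_cst.
have m01 : measurable (`[0, 1]%classic : set R) by exact: measurable_itv.
have := @cvg_differentiation_under_integral R _ _ mu Phi _ m01 a _ _ Ia
  (fun t _ => iPhi t) (fun t s _ _ => @ex_derive _ _ _ _ _ _ _ (dPhi t s))
  (fun=> `|M| + 1) (fun=> addr_ge0 (normr_ge0 M) ler01) iM KM1.
have -> : \int[mu]_(s in `[0, 1]) partial1of2 Phi a s = dot d (f (u + a *: d)).
  (* This is [S 1 - S 0] for the primitive [S] introduced next. *)
  have -> : dot d (f (u + a *: d)) = 1 * dot d (f (1 *: (u + a *: d)))
     - 0 * dot d (f (0 *: (u + a *: d))).
    by rewrite scale1r mul1r mul0r subr0.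
  pose S s := s * dot d (f (s *: (u + a *: d))).
  have dS s : is_derive s (1 : R) S (K (a, s)).
    have -> : S = id \* (fun s => dot d (f (0 + s *: (u + a *: d)))).
      by apply/funext => x; rewrite /S /= add0r.
    have H : is_derive s (1 : R) (fun s => dot d (f (0 + s *: (u + a *: d))))
        (dot d (jac f (0 + s *: (u + a *: d)) *m (u + a *: d))).
      exact: is_derive_dot_line.
    apply: is_derive_eq.
    rewrite /K /= add0r dot_mulmx sj dotC.
    rewrite -[X in X + _]/(_ * _) -[X in _ + X = _]/(_ * 1).
    ring.
  have cS : continuous S.
    move=> s; apply: differentiable_continuous; apply/derivable1_diffP.
    exact: (@ex_derive _ _ _ _ _ _ _ (dS s)).
  have -> : \int[mu]_(s in `[0, 1]) partial1of2 Phi a s =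
      \int[mu]_(s in `[0, 1]) K (a, s).
    by apply: eq_Rintegral => s _; rewrite part.
  rewrite /Rintegral.
  rewrite (@continuous_FTC2 _ _ S) //.
  - apply: continuous_subspaceT => s.
    exact: (cvg_comp _ _ (pairc a s) (cK (a, s))).
  - split.
    + by move=> s _; exact: (@ex_derive _ _ _ _ _ _ _ (dS s)).
    + by apply: cvg_at_right_filter; exact: cS.
    + by apply: cvg_at_left_filter; exact: cS.
  - by move=> s _; rewrite derive1E; exact: derive_val.
move=> H; apply: is_derive_cvg; apply: cvg_trans H.
by apply: near_eq_cvg; near=> h; rewrite /= scaler1.
Unshelve. all: by end_near. Qed.

(** The increment of the radial potential is [dot d (f (u + c *: d))] for some [c] between 0 and 1,
    and monotonicity bounds this below by [dot d (f u)]. *)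
Lemma monotone_potential n (f : 'cV[R]_n -> 'cV[R]_n) :
  C1 f -> (forall u, (jac f u)^T = jac f u) ->
  (forall u v, 0 <= dot (v - u) (f v - f u)) ->
  exists F : 'cV[R]_n -> R, forall u v, F u + dot (v - u) (f u) <= F v.
Proof.
move=> Cf sj mf.
exists (fun u => \int[mu]_(s in `[0%R, 1%R]) dot u (f (s *: u))) => u v.
set d := v - u.
have [|c] := @MVT R _ _ 0 1 ltr01
  (fun t _ => @is_derive_ray_integral n f u d t Cf sj).
  apply: continuous_subspaceT => t; apply: differentiable_continuous.
  apply/derivable1_diffP.
  exact: (@ex_derive _ _ _ _ _ _ _ (@is_derive_ray_integral n f u d t Cf sj)).
rewrite in_itv /= => /andP[c0 _].
have ud : u + d = v by rewrite addrC subrK.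
rewrite subr0 mulr1 scale1r scale0r addr0 ud => /eqP.
rewrite subr_eq => /eqP ->; rewrite addrC lerD2r.
have := mf u (u + c *: d).
by rewrite addrAC subrr add0r dotZl pmulr_rge0 // dotBr subr_ge0.
Qed.

End Potential.

(** * Legendre transforms of potentials *)

Section Legendre.
Context {R : realType}.

Lemma differentiable_linear_approx (V W : normedModType R) (f : V -> W)
    (df : {linear V -> W}) (x : V) :
  continuous df ->
  (forall e : R, 0 < e -> \forall h \near (0 : V),
     `|f (x + h) - f x - df h| <= e * `|h|) ->
  differentiable f x /\ 'd f x = df :> (V -> W).
Proof.
move=> cdf fdf.
have fo : f \o shift x = cst (f x) + df +o_ (0 : V) id.
  apply/eqaddoP => e e0; have := fdf e e0; apply: filterS => h /=.
  by rewrite !fctE /= opprD addrA (addrC h).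
have E := diff_unique cdf fo.
by split=> //; apply/diff_locallyP; rewrite E.
Qed.

Lemma dot_is_linear n (w : 'cV[R]_n) :
  linear (dot w : 'cV[R]_n -> (R : lmodType R)).
Proof. by move=> a u v; rewrite dotDr dotZr. Qed.

HB.instance Definition _ n (w : 'cV[R]_n) :=
  GRing.isLinear.Build R 'cV[R]_n R _ (dot w) (dot_is_linear w).

Lemma dot_continuous n (w : 'cV[R]_n) : continuous (dot w).
Proof.
move=> v.
exact: (@cvg_dot R _ (nbhs v) _ n (fun=> w) id w v (cvg_cst w) cvg_id).
Qed.

(* The Legendre transform [y |-> y.f^-1(y) - F(f^-1(y))] has gradient [f^-1];
   no differentiability of [f^-1] is needed. *)
Lemma legendre_gradient n (f fi : 'cV[R]_n -> 'cV[R]_n) (F : 'cV[R]_n -> R) :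
  (forall u v, F u + dot (v - u) (f u) <= F v) ->
  cancel fi f -> continuous fi ->
  exists H : 'cV[R]_n -> R, forall y,
    differentiable H y /\ 'd H y = dot (fi y) :> ('cV[R]_n -> R).
Proof.
move=> Ff fiK cfi; exists (fun y => dot y (fi y) - F (fi y)) => y.
apply: differentiable_linear_approx; first exact: dot_continuous.
move=> e e0.
have n0 : 0 < n%:R + 1 :> R by rewrite ltr_wpDl ?ler0n.
have : fi (y + h) @[h --> (0 : 'cV[R]_n)] --> fi y.
  have shift0 : y + h @[h --> (0 : 'cV[R]_n)] --> y.
    rewrite -[X in _ --> X]addr0.
    exact: (@cvgD _ _ _ (nbhs 0) _ (fun=> y) id _ _ (cvg_cst y) cvg_id).
  exact: (cvg_comp _ _ shift0 (cfi y)).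
have e1 : 0 < e / (n%:R + 1) by exact: divr_gt0.
move=> /cvgrPdist_le /(_ _ e1).
apply: filterS => h.
set u := fi y; set u' := fi (y + h) => hu.
(* The gradient inequality, used in both directions, traps the remainder between 0 and
   [dot h (u' - u)], which is o(h) by continuity of [fi]. The divisor [n%:R + 1] in the choice of
   the neighbourhood absorbs the factor of [norm_dot_le]. *)
have := Ff u u'; have := Ff u' u; rewrite !fiK => H1 H2.
rewrite -[X in X <= _]/`|dot (y + h) u' - F u' - (dot y u - F u) - dot u h|.
rewrite (dotC u).
have lo : 0 <= dot (y + h) u' - F u' - (dot y u - F u) - dot h u.
  move: H1; rewrite !(dotBl, dotDl, dotDr, dotBr) !(dotC u) !(dotC u'); lra.
rewrite ger0_norm //.
apply: (@le_trans _ _ (dot h (u' - u))).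
  move: H2; rewrite !(dotBl, dotDl, dotDr, dotBr) !(dotC u) !(dotC u'); lra.
apply: le_trans (ler_norm _) _; apply: le_trans (norm_dot_le _ _) _.
rewrite mulrAC ler_wpM2r //; rewrite distrC in hu.
apply: le_trans (ler_wpM2l _ hu) _ => //.
by rewrite mulrA ler_pdivrMr // mulrC ler_pM2l // lerDl ler01.
Qed.

End Legendre.

(** * Derivatives within an interval *)

Section MatrixCalculus.
Context {R : realType}.

Lemma mulmx_continuous m n p (A : 'M[R]_(m, n)) :
  continuous (mulmx A : 'M[R]_(n, p) -> 'M[R]_(m, p)).
Proof.
move=> v.
exact: (@cvg_mulmx R _ (nbhs v) _ _ _ _ (fun=> A) id _ _ (cvg_cst A) cvg_id).
Qed.

Lemma is_diff_mulmx m n (A : 'M[R]_(m, n)) (u : 'cV[R]_n) :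
  differentiable (mulmx A) u /\ 'd (mulmx A) u = mulmx A :> ('cV[R]_n -> 'cV[R]_m).
Proof.
split; first by apply: linear_differentiable; exact: mulmx_continuous.
by apply: diff_lin; exact: mulmx_continuous.
Qed.

Lemma differentiable_jac_approx m n (f : 'cV[R]_n -> 'cV[R]_m) (x : 'cV[R]_n) (e : R) :
  differentiable f x -> 0 < e ->
  \forall h \near (0 : 'cV[R]_n), `|f (x + h) - f x - jac f x *m h| <= e * `|h|.
Proof.
move=> df e0; have /eqaddoP/(_ e e0) := diff_locally df.
apply: filterS => h /=.
by rewrite !fctE /= opprD addrA (addrC h) diffE_jac.
Qed.

Lemma posdef_unitmx n (J : 'M[R]_n) :
  (forall h, h != 0 -> 0 < dot h (J *m h)) -> J \in unitmx.
Proof.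
move=> pJ; rewrite -unitmx_tr -row_free_unit; apply: inj_row_free => v vJ.
apply/eqP; rewrite -trmx_eq0; apply: contraT => /pJ.
by rewrite -[J]trmxK -trmx_mul vJ trmx0 dot0r ltxx.
Qed.

(** Turns a remainder that is o(Q) into one that tends to 0: near the limit, Q is bounded by
    [|q| + 1]. *)
Lemma cvg0_small (T : Type) (V W : normedModType R) (F : set_system T)
    {FF : Filter F} (rho : T -> V) (Q : T -> W) (q : W) :
  (forall e : R, 0 < e -> \forall s \near F, `|rho s| <= e * `|Q s|) ->
  Q @ F --> q -> rho @ F --> 0.
Proof.
move=> rQ Qq; apply/cvgrPdist_le => e e0.
have q0 : 0 < `|q| + 1 by rewrite ltr_wpDl.
have := rQ _ (divr_gt0 e0 q0).
have /cvgrPdist_le/(_ 1 ltr01) := Qq.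
apply: filterS2 => s Qs rs; rewrite sub0r normrN.
apply: le_trans rs _; rewrite mulrAC ler_pdivrMr // ler_pM2l //.
by rewrite -[Q s](subKr q) (le_trans (ler_normB _ _)) // lerD2l.
Qed.

End MatrixCalculus.

Section DerivativeWithin.
Context {R : realType}.
Variables (I : set R) (t : R).
Local Notation F := (within I t^').

(** Limits are unique only along a proper filter, that is, if [t] is an accumulation point of [I].
    The second point of a time interval provides this. *)
Lemma within_dnbhs_proper : time_interval I -> I t -> ProperFilter F.
Proof.
move=> [itvI [a [b [Ia Ib ab]]]] It; apply: Build_ProperFilter_ex => P.
rewrite /within /= => /nbhs_ballP[e /= e0 eP].
have [c Ic ct] : exists2 c, I c & c != t.
  have [<-|at_] := eqVneq a t; last by exists a.
  by exists b => //; rewrite gt_eqF.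
have ct0 : 0 < `|c - t| by rewrite normr_gt0 subr_eq0.
(* Moving from [t] towards [c] by the fraction [th]: the bound 1 keeps the point between them, hence
   in [I], and the other bound keeps it in the ball of radius [e]. *)
pose th := Num.min 1 (e / 2 / `|c - t|).
have th0 : 0 < th by rewrite lt_min ltr01 !divr_gt0.
have th1 : th <= 1 by rewrite ge_min lexx.
exists (t + th * (c - t)); apply: eP.
- rewrite /ball /= opprD addrA subrr sub0r normrN normrM gtr0_norm //.
  rewrite -ltr_pdivlMr // gt_min; apply/orP; right.
  by rewrite ltr_pM2r ?invr_gt0 // ltr_pdivrMr // ltr_pMr // ltr1n.
- by rewrite -subr_eq0 addrAC subrr add0r mulf_neq0 ?subr_eq0 // gt_eqF.
- have [le|lt] := leP t c.
    apply: (itvI t c) => //; rewrite lerDl mulr_ge0 ?subr_ge0 ?(ltW th0) //=.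
    by rewrite -lerBrDl ler_piMl // subr_ge0.
  apply: (itvI c t) => //; apply/andP; split.
    rewrite -subr_ge0 (_ : _ - c = (1 - th) * (t - c)); last by ring.
    by rewrite mulr_ge0 // subr_ge0 // ltW.
  by rewrite gerDl mulr_ge0_le0 // ?subr_le0 ltW.
Qed.

Lemma derivative_within_unique n (f : R -> 'cV[R]_n) (a b : 'cV[R]_n) :
  time_interval I -> I t ->
  has_derivative_within I f t a -> has_derivative_within I f t b -> a = b.
Proof.
move=> tI It fa fb; have FF := within_dnbhs_proper tI It.
exact: (cvg_unique _ fa fb).
Qed.

Lemma derivative_within_cst n (a : 'cV[R]_n) : has_derivative_within I (fun=> a) t 0.
Proof.
rewrite /has_derivative_within; under eq_fun do rewrite subrr scaler0.
exact: cvg_cst.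
Qed.

Lemma derivative_within_ext n (f h : R -> 'cV[R]_n) (a : 'cV[R]_n) :
  (forall s, I s -> f s = h s) -> I t ->
  has_derivative_within I f t a -> has_derivative_within I h t a.
Proof.
move=> fh It; apply: cvg_trans; apply: near_eq_cvg.
near=> s; have Is : I s by near: s; exact: withinT.
by rewrite !fh.
Unshelve. all: by end_near. Qed.

Lemma derivative_within_coordP n (f : R -> 'cV[R]_n) (a : 'cV[R]_n) :
  has_derivative_within I f t a <->
  forall i, ((s - t)^-1 * (f s i 0 - f t i 0)) @[s --> F] --> a i 0.
Proof.
split=> [fa i|fa].
  have H : ((s - t)^-1 *: (f s - f t)) i 0 @[s --> F] --> a i 0.
    exact: cvg_coord fa.
  by apply: cvg_trans H; apply: near_eq_cvg; apply: filterE => s; rewrite !mxE.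
apply: cvg_mx_coord => i j; rewrite ord1; apply: cvg_trans (fa i).
by apply: near_eq_cvg; apply: filterE => s; rewrite !mxE.
Qed.

Lemma derivative_within_mulmx m n (M : 'M[R]_(m, n)) (f : R -> 'cV[R]_n)
    (a : 'cV[R]_n) :
  has_derivative_within I f t a ->
  has_derivative_within I (fun s => M *m f s) t (M *m a).
Proof.
move=> fa; have H : M *m ((s - t)^-1 *: (f s - f t)) @[s --> F] --> M *m a.
  exact: (cvg_mulmx (cvg_cst M) fa).
apply: cvg_trans H; apply: near_eq_cvg; apply: filterE => s.
by rewrite -scalemxAr mulmxBr.
Qed.

Lemma derivative_within_cvg n (f : R -> 'cV[R]_n) (a : 'cV[R]_n) :
  has_derivative_within I f t a -> f @ F --> f t.
Proof.
move=> fa; apply/subr_cvg0.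
have F0 : (fun s => s - t) @ F --> 0.
  apply/subr_cvg0; apply: cvg_trans (@cvg_id _ (nbhs t)).
  by move=> P tP; apply: cvg_within; apply: cvg_within.
have H : (s - t) *: ((s - t)^-1 *: (f s - f t)) @[s --> F] --> (0 : 'cV[R]_n).
  by rewrite -(scale0r a); exact: cvgZ.
apply: cvg_trans H; apply: near_eq_cvg.
near=> s; have st : s != t.
  by near: s; apply: cvg_within; exact: withinT.
by rewrite scalerA divff ?scale1r // subr_eq0.
Unshelve. all: by end_near. Qed.

End DerivativeWithin.

(** * The chain rule and its converse for monotone maps *)

Section ChainRule.
Context {R : realType}.
Variables (I : set R) (t : R).
Local Notation F := (within I t^').

(** Only continuity of [w] at [t] is assumed, so the estimate also serves a curve whose derivative
    is still to be found. *)
Lemma derivative_within_remainder m n (f : 'cV[R]_n -> 'cV[R]_m)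
    (w : R -> 'cV[R]_n) (e : R) :
  differentiable f (w t) -> w @ F --> w t -> 0 < e ->
  \forall s \near F,
    `|(s - t)^-1 *: (f (w s) - f (w t))
       - jac f (w t) *m ((s - t)^-1 *: (w s - w t))|
    <= e * `|(s - t)^-1 *: (w s - w t)|.
Proof.
move=> df cw e0.
have w0 : (w s - w t) @[s --> F] --> (0 : 'cV[R]_n) by apply/subr_cvg0.
have : \forall s \near F, `|f (w t + (w s - w t)) - f (w t)
    - jac f (w t) *m (w s - w t)| <= e * `|w s - w t|.
  exact: w0 _ (differentiable_jac_approx df e0).
apply: filterS => s.
rewrite (addrC (w t)) subrK -scalemxAr -scalerBr !normrZ => H.
by rewrite mulrCA ler_wpM2l.
Qed.

Lemma derivative_within_comp m n (f : 'cV[R]_n -> 'cV[R]_m)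
    (w : R -> 'cV[R]_n) (dw : 'cV[R]_n) :
  differentiable f (w t) -> has_derivative_within I w t dw ->
  has_derivative_within I (f \o w) t (jac f (w t) *m dw).
Proof.
move=> df dw_.
pose Q s := (s - t)^-1 *: (w s - w t).
pose rho s := (s - t)^-1 *: (f (w s) - f (w t)) - jac f (w t) *m Q s.
have rho0 : rho @ F --> (0 : 'cV[R]_m).
  apply: (cvg0_small _ dw_) => e e0.
  by apply: derivative_within_remainder => //; exact: (derivative_within_cvg dw_).
have H : rho s + jac f (w t) *m Q s @[s --> F] --> 0 + jac f (w t) *m dw.
  by apply: (cvgD rho0); exact: (cvg_mulmx (cvg_cst _) dw_).
rewrite add0r in H; apply: cvg_trans H; apply: near_eq_cvg.
by apply: filterE => s; rewrite /rho subrK.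
Qed.

(** The quotient [P] of [f \o c], multiplied by the inverse Jacobian, converges. It differs from the
    unknown quotient [Q] of [c] by o(Q), and this is bootstrapped to o(P). *)
Lemma derivative_within_inverse n (f : 'cV[R]_n -> 'cV[R]_n)
    (c : R -> 'cV[R]_n) (a : 'cV[R]_n) :
  (forall u, differentiable f u) ->
  (forall u h, h != 0 -> 0 < dot h (jac f u *m h)) ->
  has_derivative_within I (f \o c) t a ->
  exists dc, has_derivative_within I c t dc.
Proof.
move=> df pf fa; set J := jac f (c t).
have J1 : invmx J *m J = 1%:M by rewrite mulVmx // posdef_unitmx //; exact: pf.
exists (invmx J *m a).
(* Differentiability of [f \o c] says nothing directly about [c]; its continuity at [t] comes from
   strict monotonicity of [f]. *)
have cc : c @ F --> c t.
  have cf : continuous f by move=> x; exact: differentiable_continuous.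
  have inv := continuous_inverse_monotone cf (strictly_monotone_posdef df pf) (c t).
  apply/cvgrPdist_lt => e e0; have [r r0 ur] := inv e e0.
  have /cvgrPdist_lt/(_ r r0) := derivative_within_cvg fa.
  by apply: filterS => s /=; rewrite distrC => /ur; rewrite distrC.
pose Q s := (s - t)^-1 *: (c s - c t).
pose P s := invmx J *m ((s - t)^-1 *: (f (c s) - f (c t))).
have Pa : P @ F --> invmx J *m a by exact: (cvg_mulmx (cvg_cst _) fa).
pose K := n%:R * `|invmx J| + 1.
have K0 : 0 < K by rewrite ltr_wpDl // mulr_ge0.
have small e : 0 < e -> \forall s \near F, `|P s - Q s| <= e * `|Q s|.
  move=> e0; have := derivative_within_remainder (df _) cc (divr_gt0 e0 K0).
  apply: filterS => s; rewrite -/(Q s) -/J => H.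
  have -> : P s - Q s = invmx J *m
      ((s - t)^-1 *: (f (c s) - f (c t)) - J *m Q s).
    by rewrite mulmxBr mulmxA J1 mul1mx.
  apply: le_trans (norm_mulmx_le _ _) _.
  apply: (@le_trans _ _ (K * (e / K * `|Q s|))).
    by apply: ler_pM => //; rewrite ?mulr_ge0 // /K lerDl.
  by rewrite mulrA mulrCA divff ?gt_eqF // mulr1.
have PQ0 : (P s - Q s) @[s --> F] --> (0 : 'cV[R]_n).
  apply: cvg0_small Pa => e e0.
  (* The bound 1/2 yields |Q| <= 2|P|; then e/2 yields |P - Q| <= e|P|. *)
  pose d := Num.min (e / 2) (1 / 2).
  have d0 : 0 < d by rewrite lt_min !divr_gt0.
  have d1 : d <= 1 / 2 by rewrite ge_min lexx orbT.
  have d2 : d <= e / 2 by rewrite ge_min lexx.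
  apply: filterS (small _ d0) => s H.
  have H1 : `|Q s| <= `|P s| + `|P s - Q s|.
    by rewrite -{1}(subKr (P s) (Q s)) ler_normB.
  have Q0 := normr_ge0 (Q s).
  have H2 : `|Q s| <= 2 * `|P s| by nra.
  by nra.
have H : P s - (P s - Q s) @[s --> F] --> invmx J *m a - 0 by exact: cvgB.
rewrite subr0 in H; apply: cvg_trans H; apply: near_eq_cvg.
by apply: filterE => s; rewrite subKr.
Qed.

(* Writing [A = C *m B] with [C] of full column rank and [B] of full row rank,
   [A *m f (A^T *m e)] determines [G (C^T *m e)] where
   [G c = B *m f (B^T *m c)] has a positive definite Jacobian. *)
Lemma derivative_within_of_incidence m n (A : 'M[R]_(m, n)) (f : 'cV[R]_n -> 'cV[R]_n)
    (e : R -> 'cV[R]_m) (a : 'cV[R]_m) :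
  (forall u, differentiable f u) ->
  (forall u h, h != 0 -> 0 < dot h (jac f u *m h)) ->
  has_derivative_within I (fun s => A *m f (A^T *m e s)) t a ->
  exists df, has_derivative_within I (fun s => f (A^T *m e s)) t df.
Proof.
move=> df pf Aa.
set B := row_base A; set C := col_base A.
pose G c := B *m f (B^T *m c); pose c s := C^T *m e s.
have AT : A^T = B^T *m C^T by rewrite -trmx_mul mulmx_base.
(* [C] has full column rank, so [pinvmx C] is a left inverse of it and turns the given derivative
   into one of [G \o c]. *)
have CA : pinvmx C *m A = B.
  transitivity (pinvmx C *m (C *m B)); first by rewrite mulmx_base.
  by rewrite mulmxA mulVpmx ?mul1mx // col_base_full.
have GcE s : G (c s) = pinvmx C *m (A *m f (A^T *m e s)).
  by rewrite /G /c (mulmxA (pinvmx C)) CA AT (mulmxA B^T).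
have [dfB dfBE] : (forall u, differentiable (f \o mulmx B^T) u) /\
    (forall u h, 'd (f \o mulmx B^T) u h = jac f (B^T *m u) *m (B^T *m h)).
  split=> u; have [dB dBE] := is_diff_mulmx B^T u.
    by apply: differentiable_comp => //; exact: df.
  by move=> h; rewrite diff_comp //= dBE diffE_jac.
have dG u : differentiable G u.
  have [dB _] := is_diff_mulmx B ((f \o mulmx B^T) u).
  exact: (differentiable_comp (dfB u) dB).
have jG (u h : 'cV[R]_(\rank A)) : jac G u *m h = B *m (jac f (B^T *m u) *m (B^T *m h)).
  have [dB dBE] := is_diff_mulmx B ((f \o mulmx B^T) u).
  transitivity ('d G u h); first exact/esym/diffE_jac.
  by rewrite (diff_comp (dfB u) dB) /= dBE dfBE.
(* The Jacobian of [G] is a congruence of that of [f] by [B^T], which is injective because [B] has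
   full row rank. *)
have pG u h : h != 0 -> 0 < dot h (jac G u *m h).
  move=> h0; rewrite jG dot_mulmx; apply: pf; apply: contra h0 => /eqP Bh.
  have : h^T *m B *m pinvmx B = 0 by rewrite -[B]trmxK -trmx_mul Bh trmx0 mul0mx.
  by rewrite -mulmxA mulmxVp ?row_base_free // mulmx1 -trmx_eq0 => ->.
have Gc : has_derivative_within I (G \o c) t (pinvmx C *m a).
  have := derivative_within_mulmx (M := pinvmx C) Aa.
  by under eq_fun do rewrite -GcE.
have [dc cdc] := derivative_within_inverse dG pG Gc.
have := derivative_within_comp (df _) (derivative_within_mulmx (M := B^T) cdc).
rewrite /comp; under eq_fun do rewrite mulmxA -AT.
by move=> ?; eexists; eassumption.
Qed.

End ChainRule.

(** * Blockwise maps *)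

Section Blockwise.
Context {R : realType} {k : nat} {d : 'I_k -> nat}.
Implicit Types (u v : 'cV[R]_(\sum_i d i)).

Lemma dot_submxcol u v : dot u v = \sum_i dot (submxcol u i) (submxcol v i).
Proof.
rewrite dotE -{1}(submxcolK u) -{1}(submxcolK v) tr_mxcol mul_mxrow_mxcol.
by rewrite summxE; apply: eq_bigr => i _; rewrite dotE.
Qed.

Lemma cvg_submxcol (T : Type) (F : set_system T) {FF : Filter F}
    (f : T -> 'cV[R]_(\sum_i d i)) (a : 'cV[R]_(\sum_i d i)) i :
  f @ F --> a -> submxcol (f x) i @[x --> F] --> submxcol a i.
Proof.
move=> fa; apply: cvg_mx_coord => r c; under eq_fun do rewrite mxE.
by rewrite mxE; exact: cvg_coord fa.
Qed.

Lemma cvg_mxcol (T : Type) (F : set_system T) {FF : Filter F}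
    (f : forall i, T -> 'cV[R]_(d i)) (a : forall i, 'cV[R]_(d i)) :
  (forall i, f i @ F --> a i) -> \mxcol_i f i x @[x --> F] --> \mxcol_i a i.
Proof.
move=> fa; apply: cvg_mx_coord => r c; under eq_fun do rewrite mxE.
by rewrite mxE; exact: cvg_coord (fa _).
Qed.

Variable f : forall i, 'cV[R]_(d i) -> 'cV[R]_(d i).
Arguments f : clear implicits.

Lemma blockwise_mxcol (w : forall i, 'cV[R]_(d i)) :
  blockwise f (\mxcol_i w i) = \mxcol_i f i (w i).
Proof. by apply: eq_mxcol => i; rewrite mxcolK. Qed.

Lemma dot_blockwise u v :
  dot u (blockwise f v) = \sum_i dot (submxcol u i) (f i (submxcol v i)).
Proof.
by rewrite dot_submxcol; apply: eq_bigr => i _; rewrite /blockwise mxcolK.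
Qed.

Lemma dot_blockwise_sub u v :
  dot (v - u) (blockwise f v - blockwise f u) =
  \sum_i dot (submxcol v i - submxcol u i) (f i (submxcol v i) - f i (submxcol u i)).
Proof.
rewrite dot_submxcol; apply: eq_bigr => i _.
by rewrite !submxcolB /blockwise !mxcolK.
Qed.

Lemma blockwise_continuous : (forall i, continuous (f i)) -> continuous (blockwise f).
Proof.
move=> cf u; apply: (@cvg_mxcol _ (nbhs u) (nbhs_filter u)) => i.
have cu : submxcol x i @[x --> u] --> submxcol u i.
  exact: (@cvg_submxcol _ (nbhs u) _ id u i cvg_id).
exact: (cvg_comp _ _ cu (cf i _)).
Qed.

(** Inner products split over the blocks: each block contributes a nonnegative term, and one where
    the arguments differ a positive term. *)
Lemma blockwise_monotone :
  (forall i (x y : 'cV[R]_(d i)), x != y -> 0 < dot (y - x) (f i y - f i x)) ->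
  forall u v, u != v -> 0 < dot (v - u) (blockwise f v - blockwise f u).
Proof.
move=> mf u v uv; rewrite dot_blockwise_sub.
have mf0 i x y : 0 <= dot (y - x) (f i y - f i x).
  have [->|/mf/ltW//] := eqVneq x y; by rewrite !subrr dot0r.
have [i ui] : exists i, submxcol u i != submxcol v i.
  apply/existsP; apply: contraNT uv; rewrite negb_exists => /forallP uv.
  apply/eqP/mxcolP => i; apply/eqP; exact: negbNE.
rewrite (bigD1 i) //= ltr_pwDl ?mf //.
by apply: sumr_ge0 => j _; exact: mf0.
Qed.

Lemma blockwise_bijective : (forall i, bijective (f i)) -> bijective (blockwise f).
Proof.
move=> bf.
have inv i : exists h : 'cV[R]_(d i) -> 'cV[R]_(d i),
    cancel (f i) h /\ cancel h (f i) by case: (bf i) => h; exists h.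
pose h i := sval (cid (inv i)).
have hP i : cancel (f i) (h i) /\ cancel (h i) (f i) := svalP (cid (inv i)).
exists (blockwise h) => u; rewrite /blockwise -[RHS]submxcolK;
  by apply: eq_mxcol => i; rewrite mxcolK (hP i).1 || rewrite mxcolK (hP i).2.
Qed.

End Blockwise.

Section ReactiveBlockwise.
Context {R : realType} {k : nat} {d : 'I_k -> nat}.
Variable f : forall i, 'cV[R]_(d i) -> 'cV[R]_(d i).
Arguments f : clear implicits.
Hypothesis rf : forall i, reactive_passive (f i).

Lemma reactive_passive_posdef n (h : 'cV[R]_n -> 'cV[R]_n) :
  reactive_passive h -> forall u x, x != 0 -> 0 < dot x (jac h u *m x).
Proof. by move=> [_ _ _ pd] u x x0; rewrite dotE mulmxA; exact: pd. Qed.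

Lemma reactive_passive_monotone n (h : 'cV[R]_n -> 'cV[R]_n) :
  reactive_passive h -> forall u v, u != v -> 0 < dot (v - u) (h v - h u).
Proof.
move=> rh; have [_ [dh _] _ _] := rh.
exact: strictly_monotone_posdef dh (reactive_passive_posdef rh).
Qed.

Lemma reactive_blockwise_bij : bijective (blockwise f).
Proof. by apply: blockwise_bijective => i; have [] := rf i. Qed.

Lemma reactive_blockwiseK : cancel (blockwise f) (pinv [set: _] (blockwise f)).
Proof.
move=> u; apply: pinvKV; last by rewrite inE.
by move=> x y _ _; exact: (bij_inj reactive_blockwise_bij).
Qed.

Lemma reactive_blockwiseVK : cancel (pinv [set: _] (blockwise f)) (blockwise f).
Proof.
move=> u; apply: pinvK; rewrite inE.
have [h _ fhK] := reactive_blockwise_bij.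
by exists (h u).
Qed.

Lemma reactive_blockwise_inv_continuous :
  continuous (pinv [set: _] (blockwise f)).
Proof.
have cf : continuous (blockwise f).
  apply: blockwise_continuous => i x; have [_ [df _] _ _] := rf i.
  exact: differentiable_continuous.
have mf := blockwise_monotone (fun i => reactive_passive_monotone (rf i)).
move=> y; apply/(@cvgrPdist_lt _ _ _ _ (nbhs_filter y)) => e e0.
have [r r0 ur] := continuous_inverse_monotone cf mf (pinv [set: _] (blockwise f) y) e0.
apply/nbhs_ballP; exists r => //= z yz.
rewrite distrC; apply: ur; rewrite !reactive_blockwiseVK distrC.
by move: yz; rewrite -ball_normE.
Qed.

(** The potentials of the blocks are summed first, and a single Legendre transform is taken of the
    sum. *)
Lemma reactive_blockwise_potential :
  exists H : 'cV[R]_(\sum_i d i) -> R, forall y,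
    differentiable H y /\
    'd H y = dot (pinv [set: _] (blockwise f) y) :> ('cV[R]_(\sum_i d i) -> R).
Proof.
have pot i : exists F : 'cV[R]_(d i) -> R,
    forall u v, F u + dot (v - u) (f i u) <= F v.
  have [_ Cf sf _] := rf i; apply: monotone_potential => // u v.
  have [->|/(reactive_passive_monotone (rf i))/ltW//] := eqVneq u v.
  by rewrite !subrr dot0r.
pose F i := sval (cid (pot i)).
have FP i u v : F i u + dot (v - u) (f i u) <= F i v := svalP (cid (pot i)) u v.
apply: (@legendre_gradient _ _ (blockwise f) _ (fun u => \sum_i F i (submxcol u i))).
- move=> u v; rewrite dot_blockwise -big_split.
  by apply: ler_sum => i _; rewrite submxcolB; exact: FP.
- exact: reactive_blockwiseVK.
- exact: reactive_blockwise_inv_continuous.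
Qed.

End ReactiveBlockwise.

Section DerivativeBlocks.
Context {R : realType}.
Variables (I : set R) (t : R).

Lemma eq_cvg_to (T : Type) (U : topologicalType) (F : set_system T)
    (f h : T -> U) (a b : U) :
  f =1 h -> a = b -> f @ F --> a -> h @ F --> b.
Proof. by move=> /funext -> ->. Qed.

Lemma derivative_within_col_mx m n (f : R -> 'cV[R]_m) (h : R -> 'cV[R]_n) a b :
  has_derivative_within I (fun s => col_mx (f s) (h s)) t (col_mx a b) <->
  has_derivative_within I f t a /\ has_derivative_within I h t b.
Proof.
rewrite !derivative_within_coordP; split=> [H|[Hf Hh] i].
  split=> i.
    by apply: eq_cvg_to (H (lshift n i)) => [s|]; rewrite !col_mxEu.
  by apply: eq_cvg_to (H (rshift m i)) => [s|]; rewrite !col_mxEd.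
case: (split_ordP i) => j ->.
  by apply: eq_cvg_to (Hf j) => [s|]; rewrite !col_mxEu.
by apply: eq_cvg_to (Hh j) => [s|]; rewrite !col_mxEd.
Qed.

Lemma derivative_within_mxcol k (d : 'I_k -> nat) (f : forall i, R -> 'cV[R]_(d i))
    (a : forall i, 'cV[R]_(d i)) :
  has_derivative_within I (fun s => \mxcol_i f i s) t (\mxcol_i a i) <->
  forall i, has_derivative_within I (f i) t (a i).
Proof.
split=> [/derivative_within_coordP H i|H]; apply/derivative_within_coordP => j.
  (* [tagnat.Rank i j] is the position in the stacked column of entry [j] of block [i]. *)
  have E (b : forall i, 'cV[R]_(d i)) : (\mxcol_i b i) (tagnat.Rank i j) 0 = b i j 0.
    by rewrite -[in RHS](mxcolK b i) [RHS]mxE.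
  by apply: eq_cvg_to (H (tagnat.Rank i j)) => [s|]; rewrite !E.
have /derivative_within_coordP/(_ (tagnat.sig2 j)) := H (tagnat.sig1 j).
by apply: eq_cvg_to => [s|]; rewrite !mxE.
Qed.

End DerivativeBlocks.

(** * The port-Hamiltonian form of a coupled circuit *)

Section BlockMatrices.
Context {R : realType} {k : nat}.
Variable S : coupled_circuit R k.

Lemma mul_incidence_mxcol P (v : forall i, 'cV[R]_(nedge (sub S i) P)) :
  A S P *m \mxcol_i v i = \mxcol_i (A_ S P i *m v i).
Proof.
rewrite /A mul_mxblock_mxrow; apply: eq_mxcol => i.
rewrite (bigD1 i) //= eqxx conform_mx_id big1 ?addr0 // => j.
by rewrite eq_sym => /negPf ->; rewrite mul0mx.
Qed.

Lemma mul_tr_incidence_mxcol P (v : forall i, 'cV[R]_(nnode (sub S i))) :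
  (A S P)^T *m \mxcol_i v i = \mxcol_i ((A_ S P i)^T *m v i).
Proof.
rewrite /A tr_mxblock mul_mxblock_mxrow; apply: eq_mxcol => i.
rewrite (bigD1 i) //= eqxx conform_mx_id big1 ?addr0 // => j /negPf ->.
by rewrite trmx0 mul0mx.
Qed.

Lemma mul_coupling (l : 'cV[R]_(nlam S)) :
  Alam S *m l = \mxcol_i (Alam_ S i *m l).
Proof. by rewrite mxcol_mul. Qed.

Lemma mul_tr_coupling_mxcol (v : forall i, 'cV[R]_(nnode (sub S i))) :
  (Alam S)^T *m \mxcol_i v i = \sum_i (Alam_ S i)^T *m v i.
Proof. by rewrite tr_mxcol mul_mxrow_mxcol. Qed.

Lemma col5_eta (x : 'cV[R]_(dimx S)) :
  x = col5 (usubmx x) (usubmx (dsubmx x)) (usubmx (dsubmx (dsubmx x)))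
    (usubmx (dsubmx (dsubmx (dsubmx x)))) (dsubmx (dsubmx (dsubmx (dsubmx x)))).
Proof. by rewrite /col5 !vsubmxK. Qed.

Variables (qC : 'cV[R]_(nE S Cap)) (fL : 'cV[R]_(nE S Ind)) (e : 'cV[R]_(nN S))
  (jL : 'cV[R]_(nE S Ind)) (uC : 'cV[R]_(nE S Cap))
  (jV : 'cV[R]_(nE S Vsrc)) (l : 'cV[R]_(nlam S)).

Lemma E_ph_col5 : E_ph S *m col5 qC fL e jV l = col5 (A S Cap *m qC) fL 0 0 0.
Proof.
rewrite /E_ph /col5 /row5 !mul_col_mx !mul_row_col !mul0mx.
by rewrite !mul1mx !addr0 !add0r.
Qed.

Lemma tr_E_ph_col5 : (E_ph S)^T *m col5 e jL uC jV l =
  col5 ((A S Cap)^T *m e) jL 0 0 0.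
Proof.
rewrite /E_ph /col5 /row5 !tr_col_mx !mul_row_col !tr_row_mx !mul_col_mx.
by rewrite !trmx0 !trmx1 !mul0mx !mul1mx !add_col_mx !addr0 !add0r.
Qed.

Lemma J_ph_col5 : J_ph S *m col5 e jL uC jV l =
  col5 (- (A S Ind *m jL) - A S Vsrc *m jV - Alam S *m l)
    ((A S Ind)^T *m e) 0 ((A S Vsrc)^T *m e) ((Alam S)^T *m e).
Proof.
rewrite /J_ph /col5 /row5 !mul_col_mx !mul_row_col !mul0mx !mulNmx.
by rewrite !addr0 !add0r addrA.
Qed.

Lemma B_ph_col_mx (c : 'cV[R]_(nE S Isrc)) (v : 'cV[R]_(nE S Vsrc)) :
  B_ph S *m col_mx c v = col5 (- (A S Isrc *m c)) 0 0 (- v) 0.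
Proof.
rewrite /B_ph /col5 !mul_col_mx !mul_row_col !mul0mx !mulNmx.
by rewrite !mul1mx !addr0 !add0r.
Qed.

Lemma z_ph_col5 : z_ph (col5 qC fL e jV l : 'cV[R]_(dimx S)) =
  col5 e (phiinv fL) (qinv qC) jV l.
Proof. by rewrite /z_ph /col5 !(col_mxKu, col_mxKd). Qed.

Lemma r_ph_col5 : r_ph (col5 e jL uC jV l : 'cV[R]_(dimz S)) =
  col5 (A S Res *m g ((A S Res)^T *m e)) 0 ((A S Cap)^T *m e - uC) 0 0.
Proof. by rewrite /r_ph /col5 !(col_mxKu, col_mxKd). Qed.

End BlockMatrices.

Section PortHamiltonian.
Context {R : realType} {k : nat}.
Variable S : coupled_circuit R k.

Lemma col5z_eta (w : 'cV[R]_(dimz S)) :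
  w = col5 (usubmx w) (usubmx (dsubmx w)) (usubmx (dsubmx (dsubmx w)))
    (usubmx (dsubmx (dsubmx (dsubmx w)))) (dsubmx (dsubmx (dsubmx (dsubmx w)))).
Proof. by rewrite /col5 !vsubmxK. Qed.

Lemma dot_col5 n1 n2 n3 n4 n5 (a1 b1 : 'cV[R]_n1) (a2 b2 : 'cV[R]_n2)
    (a3 b3 : 'cV[R]_n3) (a4 b4 : 'cV[R]_n4) (a5 b5 : 'cV[R]_n5) :
  dot (col5 a1 a2 a3 a4 a5) (col5 b1 b2 b3 b4 b5) =
  dot a1 b1 + (dot a2 b2 + (dot a3 b3 + (dot a4 b4 + dot a5 b5))).
Proof. by rewrite /col5 !dot_col_mx. Qed.

Lemma J_ph_skew (v w : 'cV[R]_(dimz S)) :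
  v^T *m J_ph S *m w = - (w^T *m J_ph S *m v).
Proof.
suff : dot v (J_ph S *m w) = - dot w (J_ph S *m v).
  rewrite !dotE !mulmxA => H.
  by apply/matrixP => i j; rewrite !ord1 H [RHS]mxE.
rewrite (col5z_eta v) (col5z_eta w) !J_ph_col5 !dot_col5.
have flip m n (M : 'M[R]_(m, n)) x y : dot x (M^T *m y) = dot y (M *m x).
  by rewrite dot_mulmx trmxK dotC.
rewrite !dotBr !dotNr !flip !dot0r.
ring.
Qed.

End PortHamiltonian.

Section PortHamiltonian.
Context {R : realType} {k : nat}.
Variable S : coupled_circuit R k.

(** The zero rows of [E_ph] differentiate a constant; this reads them as algebraic equations. *)
Lemma derivative_within_cstP (I : set R) (t : R) n (b a : 'cV[R]_n) :
  time_interval I -> I t ->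
  has_derivative_within I (fun=> b) t a <-> a = 0.
Proof.
move=> tI It; split=> [H|->]; last exact: derivative_within_cst.
exact: (derivative_within_unique tI It H (derivative_within_cst _ _ b)).
Qed.

(** An equivalence at a single time, for an arbitrary curve: it serves the invariance of the
    constraint space as well as both directions between circuit and PH-DAE. *)
Lemma ph_rowsP (I : set R) (t : R) (a : R -> 'cV[R]_(nE S Cap))
    (b : R -> 'cV[R]_(nE S Ind)) (c : R -> 'cV[R]_(nN S))
    (d : R -> 'cV[R]_(nE S Vsrc)) (l : R -> 'cV[R]_(nlam S))
    (cu : 'cV[R]_(nE S Isrc)) (vo : 'cV[R]_(nE S Vsrc))
    (x := fun s => col5 (a s) (b s) (c s) (d s) (l s) : 'cV[R]_(dimx S)) :
  time_interval I -> I t ->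
  has_derivative_within I (fun s => E_ph S *m x s) t
    (J_ph S *m z_ph (x t) - r_ph (z_ph (x t)) + B_ph S *m col_mx cu vo) <->
  [/\ has_derivative_within I (fun s => A S Cap *m a s) t
        (- (A S Ind *m phiinv (b t)) - A S Vsrc *m d t - Alam S *m l t
         - A S Res *m g ((A S Res)^T *m c t) - A S Isrc *m cu),
      has_derivative_within I b t ((A S Ind)^T *m c t),
      (A S Cap)^T *m c t = qinv (a t),
      (A S Vsrc)^T *m c t = vo &
      (Alam S)^T *m c t = 0].
Proof.
move=> tI It.
have -> : (fun s => E_ph S *m x s) =
    (fun s => col5 (A S Cap *m a s) (b s) 0 0 0).
  by apply/funext => s; rewrite /x E_ph_col5.
rewrite /x z_ph_col5 J_ph_col5 r_ph_col5 B_ph_col_mx /col5.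
rewrite !opp_col_mx !add_col_mx !oppr0 !addr0 !sub0r opprB.
rewrite !derivative_within_col_mx !derivative_within_cstP //.
split=> [[H1 [H2 [/subr0_eq -> [/subr0_eq -> H5]]]] //|[H1 H2 -> -> H5]].
by rewrite !subrr.
Qed.

Hypothesis Hpassive : forall i : 'I_k, passive (sub S i).

Lemma q_reactive i : reactive_passive (@q_ R k S i).
Proof. by have [] := Hpassive i. Qed.

Lemma phi_reactive i : reactive_passive (@phi_ R k S i).
Proof. by have [] := Hpassive i. Qed.

(** A quadratic form sees only the symmetric part of its matrix, so the mean value argument applies
    to Jacobians that are not symmetric. *)
Lemma g_monotone i (u v : 'cV[R]_(nedge (sub S i) Res)) :
  0 <= dot (v - u) (g_ v - g_ u).
Proof.
have [->|uv] := eqVneq u v; first by rewrite !subrr dot0r.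
have [_ _ [dg _] pg] := Hpassive i.
apply/ltW/strictly_monotone_posdef => // {uv}w h h0.
have := pg w h h0; rewrite /sym_part -scalemxAr -scalemxAl mxE.
rewrite pmulr_rgt0 ?invr_gt0 // mulmxDr mulmxDl [_ 0 0]mxE -!mulmxA -!dotE.
by rewrite (dot_mulmx h _^T) trmxK (dotC (_ *m h)) -mulr2n pmulrn_lgt0.
Qed.

Lemma qinvK : cancel (@qinv R k S) (@q R k S).
Proof. exact: reactive_blockwiseVK q_reactive. Qed.

Lemma qK : cancel (@q R k S) (@qinv R k S).
Proof. exact: reactive_blockwiseK q_reactive. Qed.

Lemma phiinvK : cancel (@phiinv R k S) (@phi R k S).
Proof. exact: reactive_blockwiseVK phi_reactive. Qed.

Lemma phiK : cancel (@phi R k S) (@phiinv R k S).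
Proof. exact: reactive_blockwiseK phi_reactive. Qed.

Lemma cvg_col_mx (T : Type) (F : set_system T) {FF : Filter F} m n
    (f : T -> 'cV[R]_m) (h : T -> 'cV[R]_n) (a : 'cV[R]_m) (b : 'cV[R]_n) :
  f @ F --> a -> h @ F --> b -> col_mx (f x) (h x) @[x --> F] --> col_mx a b.
Proof.
move=> fa hb; apply: cvg_mx_coord => i j; case: (split_ordP i) => l ->.
  by apply: eq_cvg_to (@cvg_coord _ _ _ _ _ _ _ _ l j fa) => [s|]; rewrite col_mxEu.
by apply: eq_cvg_to (@cvg_coord _ _ _ _ _ _ _ _ l j hb) => [s|]; rewrite col_mxEd.
Qed.

Lemma usubmx_continuous m n : continuous (usubmx : 'cV[R]_(m + n) -> 'cV[R]_m).
Proof.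
move=> u; apply: (@cvg_mx_coord _ _ (nbhs u) (nbhs_filter u)) => i j.
by apply: eq_cvg_to (@coord_continuous R _ _ (lshift n i) j u) => [s|]; rewrite mxE.
Qed.

Lemma dsubmx_continuous m n : continuous (dsubmx : 'cV[R]_(m + n) -> 'cV[R]_n).
Proof.
move=> u; apply: (@cvg_mx_coord _ _ (nbhs u) (nbhs_filter u)) => i j.
by apply: eq_cvg_to (@coord_continuous R _ _ (rshift m i) j u) => [s|]; rewrite mxE.
Qed.

Lemma grad_dot n (H : 'cV[R]_n -> R) (x w : 'cV[R]_n) :
  'd H x = dot w :> ('cV[R]_n -> R) -> grad H x = w.
Proof.
move=> dH; apply/matrixP => i j; rewrite ord1 mxE dH.
rewrite /dot (bigD1 i) //= big1 ?addr0 => [|l li].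
  by rewrite mxE !eqxx mulr1.
by rewrite mxE (negPf li) mulr0.
Qed.

(** The Hamiltonian is the energy stored in charges and fluxes; the zero blocks of its gradient
    match the zero columns of [E_ph]. *)
Lemma hamiltonian_exists : exists2 H : 'cV[R]_(dimx S) -> R, C1_scalar H &
  forall x, grad H x = col5 (qinv (usubmx x)) (phiinv (usubmx (dsubmx x))) 0 0 0.
Proof.
have [Hq HqP] := reactive_blockwise_potential q_reactive.
have [Hf HfP] := reactive_blockwise_potential phi_reactive.
pose us (x : 'cV[R]_(dimx S)) : 'cV[R]_(nE S Cap) := usubmx x.
pose ds (x : 'cV[R]_(dimx S)) : 'cV[R]_(nE S Ind) := usubmx (dsubmx x).
have cus : continuous us by exact: usubmx_continuous.
have cds : continuous ds.
  move=> x; have cd : dsubmx y @[y --> x] --> dsubmx x by exact: dsubmx_continuous.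
  exact: (@cvg_comp _ _ _ dsubmx usubmx _ _ _ cd (@usubmx_continuous _ _ _)).
pose us' : {linear 'cV[R]_(dimx S) -> 'cV[R]_(nE S Cap)} := usubmx.
pose ds' : {linear 'cV[R]_(dimx S) -> 'cV[R]_(nE S Ind)} := usubmx \o dsubmx.
have dus x : differentiable us x by exact: (linear_differentiable (f := us')).
have dds x : differentiable ds x by exact: (linear_differentiable (f := ds')).
have usE x : 'd us x = us :> (_ -> _) by exact: (diff_lin (f := us')).
have dsE x : 'd ds x = ds :> (_ -> _) by exact: (diff_lin (f := ds')).
pose H x := Hq (us x) + Hf (ds x).
have dHq x : differentiable (Hq \o us) x.
  by apply: differentiable_comp => //; case: (HqP (us x)).
have dHf x : differentiable (Hf \o ds) x.
  by apply: differentiable_comp => //; case: (HfP (ds x)).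
have dH x : differentiable H x by exact: (differentiableD (dHq x) (dHf x)).
have gradH x : grad H x = col5 (qinv (us x)) (phiinv (ds x)) 0 0 0.
  apply: grad_dot; apply/funext => h.
  rewrite (diffD (dHq x) (dHf x)) /= fctE.
  have [dq qE] := HqP (us x); have [df fE] := HfP (ds x).
  rewrite (diff_comp (dus x) dq) (diff_comp (dds x) df) /= usE dsE qE fE.
  rewrite -[in RHS](vsubmxK h) -[in RHS](vsubmxK (dsubmx h)) /col5 !dot_col_mx.
  by rewrite !col_mx0 (dotC 0) dot0r addr0.
exists H => //; split=> // x.
rewrite (funext gradH) /continuous_at.
have cq : continuous (@qinv R k S).
  exact: reactive_blockwise_inv_continuous q_reactive.
have cf : continuous (@phiinv R k S).
  exact: reactive_blockwise_inv_continuous phi_reactive.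
apply: (@cvg_col_mx _ (nbhs x) (nbhs_filter x)).
  exact: (@cvg_comp _ _ _ us (@qinv R k S) _ _ _ (cus x) (cq _)).
apply: (@cvg_col_mx _ (nbhs x) (nbhs_filter x)); last exact: cvg_cst.
exact: (@cvg_comp _ _ _ ds (@phiinv R k S) _ _ _ (cds x) (cf _)).
Qed.

End PortHamiltonian.

Lemma kirchhoffE (V : zmodType) (c r l v i m : V) :
  0 = c + r + l + v + i + m <-> c = - l - v - m - r - i.
Proof.
have -> : - l - v - m - r - i = - (r + l + v + i + m).
  by rewrite -!opprD (+%R.[ACl 4*1*2*5*3]).
by rewrite -!addrA; split=> [/esym/eqP|->]; rewrite ?addNr // addr_eq0 => /eqP.
Qed.

(** * The PH-DAE property and the equivalence with the circuit equations *)

Section Main.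
Context {R : realType} {k : nat}.
Variable S : coupled_circuit R k.
Hypothesis Hpassive : forall i : 'I_k, passive (sub S i).
Hypothesis Hg0 : forall i : 'I_k,
  conductance_fun (0 : 'cV[R]_(nedge (sub S i) Res)) = 0.

Definition ph_space : {vspace 'cV[R]_(dimz S)} :=
  lker (linfun (mulmx (row5 (A S Cap)^T 0 (- 1%:M) 0 0)
    : 'cV[R]_(dimz S) -> 'cV[R]_(nE S Cap))).

Lemma mem_ph_space e (jL : 'cV[R]_(nE S Ind)) uC jV l :
  (col5 e jL uC jV l \in ph_space) = ((A S Cap)^T *m e == uC).
Proof.
rewrite memv_ker lfunE /= /row5 /col5 !mul_row_col !mul0mx mulNmx mul1mx.
by rewrite !addr0 add0r subr_eq0.
Qed.

(** Keeps solutions in [ph_space], and later lets the charges of a PH-DAE solution be rebuilt from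
    its potentials. *)
Lemma ph_solution_capacitor (I : set R) (t : R) (x : R -> 'cV[R]_(dimx S))
    (u : 'cV[R]_(nE S Isrc + nE S Vsrc)) :
  time_interval I -> I t ->
  has_derivative_within I (fun s => E_ph S *m x s) t
    (J_ph S *m z_ph (x t) - r_ph (z_ph (x t)) + B_ph S *m u) ->
  (A S Cap)^T *m usubmx (dsubmx (dsubmx (x t))) = qinv (usubmx (x t)).
Proof.
move=> tI It; rewrite -(vsubmxK u).
rewrite (_ : x = fun s => col5 (usubmx (x s)) (usubmx (dsubmx (x s)))
    (usubmx (dsubmx (dsubmx (x s)))) (usubmx (dsubmx (dsubmx (dsubmx (x s)))))
    (dsubmx (dsubmx (dsubmx (dsubmx (x s)))))); last first.
  by apply/funext => s; exact: col5_eta.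
case/(ph_rowsP _ _ _ _ _ _ _ tI It) => _ _ H3 _ _.
by rewrite /col5 !(col_mxKu, col_mxKd).
Qed.

Lemma ph_is_phdae :
  is_phdae (E_ph S) (J_ph S) (B_ph S) (@z_ph R k S) (@r_ph R k S).
Proof.
have [H CH gH] := hamiltonian_exists Hpassive.
exists ph_space, H; split=> //; split.
- move=> I u x y tI sol t It; have [Ext _] := sol t It.
  by rewrite [x t]col5_eta z_ph_col5 mem_ph_space (ph_solution_capacitor tI It Ext).
- by move=> v w _ _; exact: J_ph_skew.
- move=> v; rewrite (col5z_eta v) mem_ph_space => /eqP H3.
  rewrite -dotE r_ph_col5 H3 subrr dot_col5 !dot0r !addr0 dot_mulmx.
  (* Comparing [a] with 0, where [g] vanishes, turns monotonicity into the sign of [dot a (g a)]. *)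
  set a := _ *m _; have := dot_blockwise_sub (@g_ R k S) 0 a.
  have -> : blockwise (@g_ R k S) 0 = 0.
    rewrite -[RHS]mxcol0; apply: eq_mxcol => i.
    by rewrite submxcol0; exact: Hg0.
  rewrite !subr0 => ->; apply: sumr_ge0 => i _.
  exact: g_monotone.
- move=> x; rewrite gH (col5_eta x) z_ph_col5 mem_ph_space tr_E_ph_col5 => /eqP ->.
  by rewrite /col5 !(col_mxKu, col_mxKd).
Qed.

Lemma z_ph_x_ph (e : forall i : 'I_k, R -> 'cV[R]_(nnode (sub S i)))
    (jL : forall i : 'I_k, R -> 'cV[R]_(nedge (sub S i) Ind))
    (jV : forall i : 'I_k, R -> 'cV[R]_(nedge (sub S i) Vsrc))
    (lam : R -> 'cV[R]_(nlam S)) (t : R) :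
  z_ph (x_ph e jL jV lam t) = zx_ph e jL jV lam t.
Proof.
rewrite /x_ph z_ph_col5 /zx_ph -!blockwise_mxcol.
by rewrite -[blockwise _ _]/(phi _) -[blockwise _ _]/(q _) qK ?phiK.
Qed.

Lemma circuit_ph_solution (I : set R)
    (cur : forall i : 'I_k, R -> 'cV[R]_(nedge (sub S i) Isrc))
    (vol : forall i : 'I_k, R -> 'cV[R]_(nedge (sub S i) Vsrc))
    (e : forall i : 'I_k, R -> 'cV[R]_(nnode (sub S i)))
    (jL : forall i : 'I_k, R -> 'cV[R]_(nedge (sub S i) Ind))
    (jV : forall i : 'I_k, R -> 'cV[R]_(nedge (sub S i) Vsrc))
    (lam : R -> 'cV[R]_(nlam S)) :
  time_interval I ->
  circuit_solution I cur vol e jL jV lam <->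
  forall t, I t -> has_derivative_within I (fun s => E_ph S *m x_ph e jL jV lam s) t
    (J_ph S *m z_ph (x_ph e jL jV lam t) - r_ph (z_ph (x_ph e jL jV lam t))
     + B_ph S *m u_ph cur vol t).
Proof.
move=> tI.
suff rows t : I t ->
  ((forall i, exists dq dphi,
       [/\ has_derivative_within I (fun s => q_ ((A_ S Cap i)^T *m e i s)) t dq,
           has_derivative_within I (fun s => phi_ (jL i s)) t dphi,
           0 = A_ S Cap i *m dq + A_ S Res i *m g_ ((A_ S Res i)^T *m e i t)
               + A_ S Ind i *m jL i t + A_ S Vsrc i *m jV i t
               + A_ S Isrc i *m cur i t + Alam_ S i *m lam t,
           0 = dphi - (A_ S Ind i)^T *m e i t &
           0 = (A_ S Vsrc i)^T *m e i t - vol i t]) /\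
    0 = \sum_i (Alam_ S i)^T *m e i t) <->
  has_derivative_within I (fun s => E_ph S *m x_ph e jL jV lam s) t
    (J_ph S *m z_ph (x_ph e jL jV lam t) - r_ph (z_ph (x_ph e jL jV lam t))
     + B_ph S *m u_ph cur vol t).
  by split=> H t It; apply/rows => //; exact: H.
move=> It; rewrite /x_ph /u_ph.
apply: iff_trans; last by apply: iff_sym; exact: ph_rowsP.
have -> : phiinv (\mxcol_i phi_ (jL i t)) = \mxcol_i jL i t :> 'cV[R]_(nE S Ind).
  by rewrite -blockwise_mxcol; exact: phiK.
have -> : qinv (\mxcol_i q_ ((A_ S Cap i)^T *m e i t)) =
    \mxcol_i ((A_ S Cap i)^T *m e i t) :> 'cV[R]_(nE S Cap).
  by rewrite -blockwise_mxcol; exact: qK.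
have -> : (fun s => A S Cap *m \mxcol_i q_ ((A_ S Cap i)^T *m e i s)) =
    (fun s => \mxcol_i (A_ S Cap i *m q_ ((A_ S Cap i)^T *m e i s))).
  by apply/funext => s; rewrite mul_incidence_mxcol.
rewrite !mul_tr_incidence_mxcol mul_tr_coupling_mxcol /g blockwise_mxcol.
rewrite !mul_incidence_mxcol mul_coupling.
rewrite -!mxcolN -!mxcolD.
split=> [[H Hl]|[/derivative_within_mxcol H1 /derivative_within_mxcol H2 _
  /eq_mxcolP H4 H5]].
- split=> //.
  + apply/derivative_within_mxcol => i.
    have [dq [dphi [Hq _ /kirchhoffE <- _ _]]] := H i.
    exact: derivative_within_mulmx.
  + apply/derivative_within_mxcol => i.
    by have [dq [dphi [_ Hphi _ /esym/subr0_eq <- _]]] := H i.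
  + apply: eq_mxcol => i.
    by have [dq [dphi [_ _ _ _ /esym/subr0_eq]]] := H i.
- split=> // i; have Aq := H1 i.
  have rq := q_reactive Hpassive i; have [_ [dq _] _ _] := rq.
  (* The first row differentiates only the product of [A_ S Cap i] with the charges. Once the
     charges themselves have a derivative, uniqueness identifies its product with the right-hand
     side, which is Kirchhoff's current law. *)
  have [dqi Hq] := derivative_within_of_incidence dq (reactive_passive_posdef rq) Aq.
  exists dqi, ((A_ S Ind i)^T *m e i t); split=> //.
  + exact/kirchhoffE/esym/(derivative_within_unique tI It Aq)/derivative_within_mulmx.
  + by rewrite subrr.
  + by rewrite H4 subrr.
Qed.

(** Potentials, source currents and coupling currents are components of [x], and inductor currents
    are recovered from the fluxes by [phiinv]. The charges leave no freedom: the capacitor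
    constraint forces them to be [q] of the branch voltages. *)
Lemma ph_solution_x_ph (I : set R)
    (cur : forall i : 'I_k, R -> 'cV[R]_(nedge (sub S i) Isrc))
    (vol : forall i : 'I_k, R -> 'cV[R]_(nedge (sub S i) Vsrc))
    (x : R -> 'cV[R]_(dimx S)) (y : R -> 'cV[R]_(nE S Isrc + nE S Vsrc)) :
  time_interval I ->
  phdae_solution (E_ph S) (J_ph S) (B_ph S) (@z_ph R k S) (@r_ph R k S)
    I (u_ph cur vol) x y ->
  exists e jL jV lam, forall t, I t -> x t = x_ph e jL jV lam t.
Proof.
move=> tI sol.
exists (fun i t => submxcol (usubmx (dsubmx (dsubmx (x t)))) i).
exists (fun i t => submxcol (phiinv (usubmx (dsubmx (x t)))) i).
exists (fun i t => submxcol (usubmx (dsubmx (dsubmx (dsubmx (x t))))) i).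
exists (fun t => dsubmx (dsubmx (dsubmx (dsubmx (x t))))) => t It.
have [Ext _] := sol t It; have H3 := ph_solution_capacitor tI It Ext.
rewrite [LHS]col5_eta /x_ph; congr (col5 _ _ _ _ _).
- rewrite -blockwise_mxcol -mul_tr_incidence_mxcol submxcolK H3.
  exact/esym/qinvK.
- by rewrite -blockwise_mxcol submxcolK; exact/esym/phiinvK.
- by rewrite submxcolK.
- by rewrite submxcolK.
Qed.

End Main.

Unset Implicit Arguments.

Theorem lemma17 (R : realType) (k : nat) (hk : (2 <= k)%N)
    (S : coupled_circuit R k)
    (Hsound : sound S)
    (Hpassive : forall i : 'I_k, passive (sub S i))
    (* zero voltage drop gives zero resistive current *)
    (Hg0 : forall i : 'I_k, conductance_fun (0 : 'cV[R]_(nedge (sub S i) Res)) = 0) :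
  is_phdae (E_ph S) (J_ph S) (B_ph S) (@z_ph R k S) (@r_ph R k S) /\
  (forall (e : forall i : 'I_k, R -> 'cV[R]_(nnode (sub S i)))
      (jL : forall i : 'I_k, R -> 'cV[R]_(nedge (sub S i) Ind))
      (jV : forall i : 'I_k, R -> 'cV[R]_(nedge (sub S i) Vsrc))
      (lam : R -> 'cV[R]_(nlam S)) (t : R),
    z_ph (x_ph e jL jV lam t) = zx_ph e jL jV lam t) /\
  (forall (I : set R)
      (cur : forall i : 'I_k, R -> 'cV[R]_(nedge (sub S i) Isrc))
      (vol : forall i : 'I_k, R -> 'cV[R]_(nedge (sub S i) Vsrc)),
    time_interval I ->
    (forall (e : forall i : 'I_k, R -> 'cV[R]_(nnode (sub S i)))
        (jL : forall i : 'I_k, R -> 'cV[R]_(nedge (sub S i) Ind))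
        (jV : forall i : 'I_k, R -> 'cV[R]_(nedge (sub S i) Vsrc))
        (lam : R -> 'cV[R]_(nlam S)),
      circuit_solution I cur vol e jL jV lam <->
      exists y, phdae_solution (E_ph S) (J_ph S) (B_ph S) (@z_ph R k S) (@r_ph R k S)
                  I (u_ph cur vol) (x_ph e jL jV lam) y) /\
    (forall (x : R -> 'cV[R]_(dimx S)) (y : R -> 'cV[R]_(nE S Isrc + nE S Vsrc)),
      phdae_solution (E_ph S) (J_ph S) (B_ph S) (@z_ph R k S) (@r_ph R k S)
        I (u_ph cur vol) x y ->
      exists (e : forall i : 'I_k, R -> 'cV[R]_(nnode (sub S i)))
        (jL : forall i : 'I_k, R -> 'cV[R]_(nedge (sub S i) Ind))
        (jV : forall i : 'I_k, R -> 'cV[R]_(nedge (sub S i) Vsrc))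
        (lam : R -> 'cV[R]_(nlam S)),
        circuit_solution I cur vol e jL jV lam /\
        forall t, I t -> x t = x_ph e jL jV lam t)).
Proof.
have zE := z_ph_x_ph Hpassive.
split; [exact: ph_is_phdae|split=> // I cur vol tI; split].
- move=> e jL jV lam; rewrite (circuit_ph_solution Hpassive) //; split=> [sol|[y sol]].
    exists (fun t => (B_ph S)^T *m z_ph (x_ph e jL jV lam t)) => t It.
    by split=> //; exact: sol.
  by move=> t It; have [] := sol t It.
- move=> x y sol.
  have [e [jL [jV [lam xE]]]] := ph_solution_x_ph Hpassive tI sol.
  exists e, jL, jV, lam; split=> //.
  apply/(circuit_ph_solution Hpassive) => // t It; rewrite -xE //.
  (* The two curves agree on [I] only, which suffices because derivatives are taken within [I]. *)
  by apply: derivative_within_ext (sol t It).1 => // s Is; rewrite xE.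
Qed.
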